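(* Let $\alpha>0$ and $\gamma=1/\alpha$. Assume that $U$ satisfies $\lim_{t\to\infty}U(tx)/U(t)=x^{\gamma}$ for every $x>0$, and that there exist $t_0>0$ and $\eta\in[0,1)$ such that $U(tx)/U(t)\ge(1-\eta)x^{\gamma}+\eta$ for all $t\ge t_0$ and $x\ge 1$. Suppose the network is generated under either the ordered Norros-Reittu model with $\alpha>0$ or the ordered Chung-Lu model with $\alpha>2$. Let $k(n)$ be such that $k(n)\to\infty$ and $k(n)\,(\log n)^{\alpha}/n^{\frac{1}{4\alpha+1}}\to0$ as $n\to\infty$. Then, as $n\to\infty$, $$\sqrt{k(n)}\left|\hat\gamma^{\mathrm{Hill}}_D(n)-\hat\gamma^{\mathrm{Hill}}_W(n)\right|\xrightarrow{p}0\quad\text{and}\quad\sqrt{k(n)}\left|\hat\gamma^{\mathrm{Pick}}_D(n)-\hat\gamma^{\mathrm{Pick}}_W(n)\right|\xrightarrow{p}0 .$$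
   Context: Notation: $[n]=\{1,\dots,n\}$, $x\wedge y=\min(x,y)$, and $\xrightarrow{p}$ denotes convergence in probability. Let $F$ be a continuous distribution function supported on the positive reals, and let $W_1,W_2,\dots,W_n$ be independent with distribution function $F$. Let $W_{(1)}(n)\ge W_{(2)}(n)\ge\dots\ge W_{(n)}(n)$ be their decreasing order statistics and $L(n)=\sum_{i=1}^n W_i$. Let $U(t)=F^{\leftarrow}(1-1/t)$ for $t\ge1$, where $F^{\leftarrow}(y)=\inf\{x:F(x)\ge y\}$. Ordered random graph models on $n$ nodes: $\{A_{ij}(n)\}_{i,j=1}^n$ is a random symmetric adjacency matrix whose entries with $1\le i\le j\le n$ are, conditionally on $\{W_{(i)}(n)\}_{i\in[n]}$, independent. In the (ordered) Norros-Reittu model, $A_{ij}(n)\mid\{W_{(i)}(n)\}_{i\in[n]}\sim\mathrm{Poisson}\left(W_{(i)}(n)W_{(j)}(n)/L(n)\right)$ for $1\le i\le j\le n$. In the (ordered) Chung-Lu model, $A_{ij}(n)\mid\{W_{(i)}(n)\}_{i\in[n]}\sim\mathrm{Bernoulli}\left(\frac{W_{(i)}(n)W_{(j)}(n)}{L(n)}\wedge1\right)$ for $1\le i\le j\le n$. The degree of node $i$ is $D_i(n)=\sum_{j=1}^n A_{ij}(n)$, and $D_{(1)}(n)\ge D_{(2)}(n)\ge\dots\ge D_{(n)}(n)$ are the decreasing order statistics of the degrees $D_1(n),\dots,D_n(n)$. $k(n)$ denotes a sequence of positive integers. The degree-based Hill and Pickands estimators are $$\hat\gamma^{\mathrm{Hill}}_D(n)=\frac{1}{k(n)-1}\sum_{i=1}^{k(n)-1}\log\left(\frac{D_{(i)}(n)}{D_{(k(n))}(n)}\right),\qquad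 \hat\gamma^{\mathrm{Pick}}_D(n)=\frac{1}{\log2}\log\left(\frac{D_{(k(n))}(n)-D_{(2k(n))}(n)}{D_{(2k(n))}(n)-D_{(4k(n))}(n)}\right).$$ Their weight-based counterparts $\hat\gamma^{\mathrm{Hill}}_W(n)$ and $\hat\gamma^{\mathrm{Pick}}_W(n)$ are defined by the same formulas with every $D_{(i)}(n)$ replaced by $W_{(i)}(n)$. *)

(* Defs.v *)
From mathcomp Require Import all_boot all_order all_algebra.
From mathcomp Require Import all_classical all_reals all_analysis.
From mathcomp Require Import measurable_realfun.
Import Order.TTheory GRing.Theory Num.Theory.
Import numFieldNormedType.Exports.

Set Implicit Arguments.
Unset Strict Implicit.
Unset Printing Implicit Defensive.

Local Open Scope classical_set_scope.
Local Open Scope ring_scope.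

Definition distribution_function (R : realType) (F : R -> R) : Prop :=
  [/\ {homo F : x y / x <= y}, right_continuous F,
      F x @[x --> -oo] --> (0 : R) & F x @[x --> +oo] --> (1 : R)].

Definition generalized_inverse (R : realType) (F : R -> R) (y : R) : R :=
  inf [set x | y <= F x].

(* Only meaningful for t > 1: for t <= 1 the set under the infimum is not
   bounded below and [inf] returns 0. *)
Definition tail_quantile (R : realType) (F : R -> R) (t : R) : R :=
  generalized_inverse F (1 - t^-1).

(* [ord_stat x i] is the i-th largest value of x, counting from i = 1. *)
Definition ord_stat (R : realType) (n : nat) (x : 'I_n -> R) (i : nat) : R :=
  nth 0 (sort (>=%R) (codom x)) i.-1.

(* In the two estimators, [x i] stands for the i-th largest observation. The
   library conventions ln y = 0 for y <= 0 and y / 0 = 0 give them a value where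
   the formulas are undefined. *)
Definition hill (R : realType) (x : nat -> R) (k : nat) : R :=
  (k%:R - 1)^-1 * \sum_(1 <= i < k) ln (x i / x k).

Definition pickands (R : realType) (x : nat -> R) (k : nat) : R :=
  (ln 2)^-1 *
  ln ((x k - x (2 * k)%N) / (x (2 * k)%N - x (4 * k)%N)).

Definition mutual_independence d (T : measurableType d) (R : realType)
    (P : probability T R) d' (T' : measurableType d') (I : finType)
    (X : I -> {RV P >-> T'}) : Prop :=
  forall (J : {set I}) (B : I -> set T'),
    (forall i, i \in J -> measurable (B i)) ->
    P (\bigcap_(i in [set` J]) (X i @^-1` B i)) =
    (\prod_(i in J) P (X i @^-1` B i))%E.

(* f is a version of the conditional probability P(E | G), where G is a
   sub-sigma-algebra. *)
Definition is_cond_prob d (T : measurableType d) (R : realType)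
    (P : probability T R) (G : set (set T)) (E : set T) (f : T -> \bar R) :
    Prop :=
  (forall B : set (\bar R), measurable B -> G (f @^-1` B)) /\
  forall H, G H -> (\int[P]_(w in H) f w)%E = P (E `&` H).

Definition cond_mutual_independence d (T : measurableType d) (R : realType)
    (P : probability T R) (G : set (set T)) d' (T' : measurableType d')
    (I : finType) (X : I -> {RV P >-> T'}) : Prop :=
  forall (J : {set I}) (B : I -> set T') (f : I -> T -> \bar R),
    (forall i, i \in J -> measurable (B i)) ->
    (forall i, i \in J -> is_cond_prob P G (X i @^-1` B i) (f i)) ->
    is_cond_prob P G (\bigcap_(i in [set` J]) (X i @^-1` B i))
      (fun w => (\prod_(i in J) f i w)%E).

(* [law r] is the distribution on nat of an entry whose parameter
   W_(i) W_(j) / L equals r. Nodes i : 'I_n are counted from 0, so node i carries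
   the weight of rank i.+1. *)
Definition ordered_random_graph (R : realType) (law : R -> set nat -> \bar R)
    d (T : measurableType d) (P : probability T R) (n : nat)
    (W : 'I_n -> {RV P >-> R}) (A : 'I_n -> 'I_n -> {RV P >-> nat}) : Prop :=
  let Word (i : 'I_n) (w : T) := ord_stat (fun j => W j w) i.+1 in
  let L (w : T) := \sum_(i < n) W i w in
  let G := g_sigma_preimage Word in
  [/\ forall i j w, A i j w = A j i w,
      cond_mutual_independence G
        (fun e : {e : 'I_n * 'I_n | (e.1 <= e.2)%N} =>
          A (val e).1 (val e).2) &
      forall (i j : 'I_n) (B : set nat), (i <= j)%N ->
        is_cond_prob P G (A i j @^-1` B)
          (fun w => law (Word i w * Word j w / L w) B)].

(* The last argument of [poisson_prob], here 0, is a dummy. *)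
Definition ordered_norros_reittu (R : realType) d (T : measurableType d)
    (P : probability T R) (n : nat) (W : 'I_n -> {RV P >-> R})
    (A : 'I_n -> 'I_n -> {RV P >-> nat}) : Prop :=
  ordered_random_graph (fun r => poisson_prob r 0) W A.

(* [bernoulli_prob] lives on bool and is transported to nat. *)
Definition ordered_chung_lu (R : realType) d (T : measurableType d)
    (P : probability T R) (n : nat) (W : 'I_n -> {RV P >-> R})
    (A : 'I_n -> 'I_n -> {RV P >-> nat}) : Prop :=
  ordered_random_graph
    (fun r B => bernoulli_prob (Num.min r 1) (nat_of_bool @^-1` B)) W A.

Definition degree (R : realType) d (T : measurableType d) (P : probability T R)
    (n : nat) (A : 'I_n -> 'I_n -> {RV P >-> nat}) (i : 'I_n) (w : T) : R :=
  (\sum_(j < n) A i j w)%N%:R.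

Definition weight_stat (R : realType) d (T : measurableType d)
    (P : probability T R) (n : nat) (W : 'I_n -> {RV P >-> R}) (w : T) :
    nat -> R :=
  ord_stat (fun i => W i w).

Definition degree_stat (R : realType) d (T : measurableType d)
    (P : probability T R) (n : nat) (A : 'I_n -> 'I_n -> {RV P >-> nat})
    (w : T) : nat -> R :=
  ord_stat (fun i => degree A i w).

(* The n-th variable may live on its own probability space. *)
Definition cvg_in_probability (R : realType) (d : nat -> measure_display)
    (T : forall n, measurableType (d n)) (P : forall n, probability (T n) R)
    (X : forall n, T n -> R) (c : R) : Prop :=
  forall eps : R, 0 < eps ->
    P n [set w | eps < `|X n w - c|] @[n --> \oo] --> 0%E.

(* Main.v *)
Require Import Defs.
From mathcomp Require Import all_boot all_order all_algebra.
From mathcomp Require Import all_classical all_reals all_analysis.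
From mathcomp Require Import measurable_realfun ring lra zify.
Import Order.TTheory GRing.Theory Num.Theory.
Import numFieldNormedType.Exports.

(** Given the weights, the degree of the node of rank i is a sum of independent
    entries whose means W_(i) W_(j) / L add up to W_(i). In the Norros-Reittu
    model this is exact. In the Chung-Lu model with alpha > 2 it holds as soon
    as no mean is truncated at 1, and this has probability tending to 1 because
    the largest weight is then negligible with respect to the square root of the
    total weight, which is at least of order n.

    The proof transfers this node-wise concentration to the order statistics.
    Fix a small e > 0, let delta = e / sqrt k and let m = U(n / 6k), a level that
    W_(4k) exceeds with probability tending to 1. Chernoff bounds
    ([degree_upper_tail], [degree_lower_tail]) show that the degree of node i
    exceeds (1 + delta) max(W_(i), m), or falls below (1 - delta) W_(i) although
    W_(i) >= m, with probability at most exp (1 - m delta^2 / 8). A union bound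
    over all n nodes costs a factor n, which is harmless because the growth
    condition on k makes m / k much larger than log n ([rank_rate_growth],
    [degree_deviation_cvg0]). Since the two envelopes are monotone in the weight,
    sorting the degrees preserves them: D_(i) = W_(i) (1 + O(delta)) uniformly in
    i <= 4k ([ord_stat_sandwich]).

    The Hill estimator is an average of logarithms of ratios, so its error is
    O(delta) ([hill_close]). The Pickands estimator involves the differences
    W_(k) - W_(2k) and W_(2k) - W_(4k), and a relative error on the terms passes to
    a difference only if the terms differ by a factor bounded away from 1. This
    is where the lower bound on U(tx) / U(t) is used ([tail_quantile_gap]): a second
    Chernoff bound, on the number of weights above a quantile, locates W_(k),
    W_(2k) and W_(4k) between quantiles that differ by a factor of at least 1 + c
    ([weights_typical_whp], [pickands_close]). Multiplied by sqrt k, both errors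
    are a constant times e, on an event of probability tending to 1.

    Conditioning on the weights is handled without conditional expectations: the
    event on which the weight of a node is fixed up to an additive error of 1
    belongs to the sigma-algebra that the weights generate, and the model gives the joint law of
    the entries on such an event as an integral ([joint_row]). The Chernoff bound
    [chernoff] is stated for mixtures of product laws of this kind; applied on
    the whole space with constant laws, it also gives the bound on the weights. *)

Set Implicit Arguments.
Unset Strict Implicit.
Unset Printing Implicit Defensive.

Local Open Scope classical_set_scope.
Local Open Scope ring_scope.

(** * Order statistics *)

Section order_statistics.
Context {R : realType}.
Implicit Types (t : R) (n i : nat).

Lemma size_sort_codom n (x : 'I_n -> R) : size (sort (>=%R) (codom x)) = n.
Proof. by rewrite size_sort size_codom card_ord. Qed.

Lemma ge_ord_trans : transitive (>=%R : rel R).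
Proof. by move=> b a c ba cb; exact: le_trans cb ba. Qed.

Lemma ord_stat_homo n (x : 'I_n -> R) i j :
  (i <= j <= n)%N -> (0 < j)%N -> ord_stat x j <= ord_stat x i.
Proof.
move=> /andP[ij jn] j0; rewrite /ord_stat.
have srt : sorted (>=%R) (sort (>=%R) (codom x)).
  by apply: sort_sorted => a b; exact: le_total.
by apply: (sorted_leq_nth ge_ord_trans _ _ srt) => //;
  rewrite -?topredE /= ?size_sort_codom; [move=> a; exact: lexx | lia..].
Qed.

Lemma card_predE (I : finType) (a : pred I) : #|[pred j | a j]| = (\sum_j a j)%N.
Proof.
by rewrite -sum1_card big_mkcond; apply: eq_bigr => j _; rewrite inE; case: (a j).
Qed.

Lemma count_sort_codom n (x : 'I_n -> R) (a : pred R) :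
  count a (sort (>=%R) (codom x)) = #|[pred j | a (x j)]|.
Proof.
rewrite count_sort codomE count_map -size_filter cardE; congr size.
by rewrite enumT; apply: eq_filter => j.
Qed.

(** Every property of order statistics used below is read off from this count:
    it turns a statement about sorting into one about the values x j. *)
Lemma le_ord_stat n (x : 'I_n -> R) i t : (0 < i <= n)%N ->
  (t <= ord_stat x i) = (i <= #|[pred j | (t <= x j)%R]|)%N.
Proof.
case: i => // i; rewrite ltnS => /= ilt.
pose s := sort (>=%R) (codom x).
have sz : size s = n := size_sort_codom x.
have mono a b : (a <= b < n)%N -> s`_b <= s`_a.
  by move=> abn; apply: (@ord_stat_homo n x a.+1 b.+1) => //.
rewrite -(count_sort_codom x (fun y => t <= y)) /ord_stat -/s /=.
apply/idP/idP => [tle|].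
  rewrite -(cat_take_drop i.+1 s) count_cat.
  apply: leq_trans (leq_addr _ _); rewrite -[leqLHS](@size_takel i.+1 _ s) ?sz//.
  rewrite leq_eqVlt eq_sym -all_count; apply/orP; left.
  apply/(all_nthP 0) => j; rewrite size_takel ?sz// => ji.
  by rewrite nth_take//; apply: le_trans tle _; apply: mono; lia.
apply: contraLR; rewrite -ltNge -leqNgt => lt_t.
rewrite -(cat_take_drop i s) count_cat.
have -> : count (fun y => t <= y) (drop i s) = 0%N.
  apply/eqP; rewrite -leqn0 leqNgt -has_count -all_predC.
  apply/(all_nthP 0) => j; rewrite size_drop sz => jn /=.
  by rewrite nth_drop -ltNge; apply: le_lt_trans lt_t; apply: mono; lia.
rewrite addn0; apply: leq_trans (count_size _ _) _.
by rewrite size_take; case: ifP; lia.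
Qed.

Lemma sum_ord_stat n (x : 'I_n -> R) :
  \sum_(i < n) ord_stat x i.+1 = \sum_(i < n) x i.
Proof.
transitivity (\sum_(y <- sort (>=%R) (codom x)) y).
  by rewrite (big_nth 0) size_sort_codom big_mkord.
by rewrite (perm_big _ (permEl (perm_sort _ _))) /= codomE big_map big_enum.
Qed.

Lemma measurable_ord_stat d (T : measurableType d) n (X : 'I_n -> T -> R) i :
  (forall j, measurable_fun setT (X j)) ->
  measurable_fun setT (fun w => ord_stat (fun j => X j w) i).
Proof.
move=> mX.
have [jlt|jge] := ltnP i.-1 n; last first.
  rewrite (_ : (fun w => _) = cst 0); first exact: measurable_cst.
  by apply/funext => w; rewrite /ord_stat nth_default// size_sort_codom.
(* The ranks 0 and 1 denote the same entry of the sorted sequence. *)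
have -> : (fun w => ord_stat (fun j => X j w) i) =
          (fun w => ord_stat (fun j => X j w) i.-1.+1) by [].
apply: (measurability (@RGenCInfty.G R)) => [|/= _ [_] [t] -> <-].
  exact: RGenCInfty.measurableE.
rewrite setTI.
have -> : (fun w => ord_stat (fun j => X j w) i.-1.+1) @^-1` `[t, +oo[%classic =
    (fun w => i.-1.+1%:R <= \sum_(j < n) (t <= X j w)%R%:R :> R) @^-1` [set true].
  apply/seteqP; split => w /=; rewrite in_itv/= andbT le_ord_stat//;
    by rewrite card_predE -natr_sum ler_nat.
rewrite -[X in measurable X]setTI; apply: measurable_fun_ler => //.
apply: measurable_sum => j.
rewrite (_ : (fun w => _) = (fun w => if t <= X j w then 1 else 0)).
  by apply: measurable_fun_ifT => //; exact: measurable_fun_ler.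
by apply/funext => w; case: ifP.
Qed.

Lemma widen_inj m n (h : (m <= n)%N) : injective (widen_ord h).
Proof. by move=> a b /(congr1 val) /= ab; exact: val_inj. Qed.

Lemma ge_ord_stat n (x : 'I_n -> R) i t : (0 < i <= n)%N ->
  (forall j : 'I_n, (j < i)%N -> t <= x j) -> t <= ord_stat x i.
Proof.
move=> /andP[i0 ile] tx; rewrite le_ord_stat ?i0//.
rewrite -[leqLHS]card_ord -(card_imset _ (@widen_inj _ _ ile)).
by apply: subset_leq_card; apply/fintype.subsetP => _ /imsetP[j _ ->]; rewrite !inE tx /=.
Qed.

Lemma ord_stat_le n (x : 'I_n -> R) i t : (0 < i <= n)%N ->
  (forall j : 'I_n, (i.-1 <= j)%N -> x j <= t) -> ord_stat x i <= t.
Proof.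
move=> /andP[i0 ile] xt; rewrite leNgt; apply/negP => t_lt.
have := lexx (ord_stat x i); rewrite le_ord_stat ?i0//.
apply/negP; rewrite -ltnNge; case: i i0 ile xt t_lt => // i _ ile xt t_lt.
rewrite ltnS -[leqRHS]card_ord -(card_imset _ (@widen_inj _ _ (ltnW ile))).
apply: subset_leq_card; apply/fintype.subsetP => j; rewrite !inE => t_le.
have ji : (j < i)%N.
  by rewrite ltnNge; apply/negP => /xt/(le_trans t_le); rewrite leNgt t_lt.
by apply/imsetP; exists (Ordinal ji) => //; exact: val_inj.
Qed.

(** The two envelopes are monotone in the weight, which is what makes them
    survive the sorting: below rank i every upper bound is at most the one at
    rank i, and above rank i every lower bound is at least the one at rank i.
    The upper envelope has to be controlled at all nodes, small ones included,
    since any node may end up with a large degree; the floor m, below the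
    weights of interest, is what a union bound can afford there. *)
Lemma ord_stat_sandwich n (w x : 'I_n -> R) (dl m : R) l :
  0 <= dl <= 1 -> (0 < l <= n)%N -> m <= ord_stat w l ->
  (forall j : 'I_n, x j <= (1 + dl) * Num.max (ord_stat w j.+1) m) ->
  (forall j : 'I_n, m <= ord_stat w j.+1 -> (1 - dl) * ord_stat w j.+1 <= x j) ->
  forall i, (0 < i <= l)%N ->
  (1 - dl) * ord_stat w i <= ord_stat x i <= (1 + dl) * ord_stat w i.
Proof.
move=> dl01 ln ml hi lo i il.
have mi : m <= ord_stat w i by apply: le_trans ml _; apply: ord_stat_homo; lia.
apply/andP; split.
  apply: ge_ord_stat => [|j ji]; first lia.
  have ij : ord_stat w i <= ord_stat w j.+1 by apply: ord_stat_homo; lia.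
  apply: le_trans (lo j (le_trans mi ij)).
  by apply: ler_wpM2l => //; lra.
apply: ord_stat_le => [|j ij]; first lia.
apply: le_trans (hi j) _; apply: ler_wpM2l; first lra.
rewrite ge_max mi andbT; apply: ord_stat_homo; have := ltn_ord j; lia.
Qed.

Lemma ord_stat_attained n (x : 'I_n -> R) (i : 'I_n) : exists j, ord_stat x i.+1 = x j.
Proof.
have : ord_stat x i.+1 \in sort (>=%R) (codom x).
  by apply: mem_nth; rewrite size_sort_codom; exact: ltn_ord.
by rewrite mem_sort => /codomP.
Qed.

End order_statistics.

(** * Perturbation of the two estimators *)

Section perturbation.
Context {R : realType}.

Lemma ln_close (a b dl : R) : 0 < b -> dl <= 2^-1 -> `|a - b| <= dl * b ->
  0 < a /\ `|ln a - ln b| <= 2 * dl.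
Proof.
move=> b0 dl2; rewrite ler_norml => /andP[lo hi].
have dl0 : 0 <= dl by nra.
have a0 : 0 < a by nra.
split=> //; rewrite -ln_div ?posrE//; set u := a / b.
have u_lo : 1 - dl <= u by rewrite ler_pdivlMr//; lra.
have u_hi : u <= 1 + dl by rewrite ler_pdivrMr//; lra.
have u0 : 0 < u by lra.
rewrite ler_norml; apply/andP; split.
  rewrite lerNl -lnV ?posrE//.
  have -> : u^-1 = 1 + (u^-1 - 1) by lra.
  have uV : u^-1 <= 1 + 2 * dl.
    by rewrite -div1r ler_pdivrMr//; nra.
  have uV0 : 0 < u^-1 by rewrite invr_gt0.
  by apply: le_trans (le_ln1Dx _) _; lra.
have -> : u = 1 + (u - 1) by lra.
by apply: le_trans (le_ln1Dx _) _; lra.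
Qed.

Lemma hill_close (x w : nat -> R) (k : nat) (dl : R) :
  (1 < k)%N -> dl <= 2^-1 ->
  (forall i, (0 < i <= k)%N -> 0 < w i /\ `|x i - w i| <= dl * w i) ->
  `|hill x k - hill w k| <= 4 * dl.
Proof.
move=> k1 dl2 xw.
have k0 : 0 < k%:R - 1 :> R by rewrite subr_gt0 ltr1n.
rewrite /hill -mulrBr -sumrB normrM gtr0_norm ?invr_gt0//.
rewrite mulrC ler_pdivrMr//.
apply: le_trans (ler_norm_sum _ _ _) _.
have -> : 4 * dl * (k%:R - 1) = \sum_(1 <= i < k) (4 * dl).
  by rewrite sumr_const_nat -[RHS]mulr_natr natrB// ltnW.
rewrite !big_nat; apply: ler_sum => i /andP[i1 ik].
have [wi ci] := xw i ltac:(lia); have [wk ck] := xw k ltac:(lia).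
have [xi0 xi] := ln_close wi dl2 ci; have [xk0 xk] := ln_close wk dl2 ck.
rewrite !ln_div ?posrE//.
have -> : ln (x i) - ln (x k) - (ln (w i) - ln (w k)) =
  (ln (x i) - ln (w i)) - (ln (x k) - ln (w k)) by lra.
by apply: le_trans (ler_normB _ _) _; lra.
Qed.

(** A relative error on a and b is a relative error on a - b, up to the factor
    (a + b) / (a - b), and a >= (1 + c) b bounds this factor by (2 + c) / c. *)
Lemma sub_close (a b a' b' dl c : R) : 0 < c -> 0 < b -> 0 <= dl ->
  (1 + c) * b <= a -> `|a' - a| <= dl * a -> `|b' - b| <= dl * b ->
  0 < a - b /\ `|(a' - b') - (a - b)| <= (2 + c) / c * dl * (a - b).
Proof.
move=> c0 b0 dl0 ba ca cb.
have ab : 0 < a - b by nra.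
split=> //.
have -> : a' - b' - (a - b) = (a' - a) - (b' - b) by lra.
apply: le_trans (ler_normB _ _) _; apply: le_trans (lerD ca cb) _.
have -> : dl * a + dl * b = dl * (a + b) by lra.
have -> : (2 + c) / c * dl * (a - b) = dl * ((2 + c) * (a - b) / c).
  by field; rewrite gt_eqF.
by apply: ler_wpM2l => //; rewrite ler_pdivlMr//; nra.
Qed.

Lemma pickands_close (x w : nat -> R) (k : nat) (dl c : R) :
  (0 < k)%N -> 0 < c -> 0 <= dl -> (2 + c) / c * dl <= 2^-1 ->
  (forall i, (0 < i <= 4 * k)%N -> 0 < w i /\ `|x i - w i| <= dl * w i) ->
  (1 + c) * w (2 * k)%N <= w k -> (1 + c) * w (4 * k)%N <= w (2 * k)%N ->
  `|pickands x k - pickands w k| <= (ln 2)^-1 * (4 * ((2 + c) / c * dl)).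
Proof.
move=> k0 c0 dl0 dl2 xw w2 w4.
have [w1p c1] := xw k ltac:(lia).
have [w2p c2] := xw (2 * k)%N ltac:(lia).
have [w4p c4] := xw (4 * k)%N ltac:(lia).
have [d1 e1] := sub_close c0 w2p dl0 w2 c1 c2.
have [d2 e2] := sub_close c0 w4p dl0 w4 c2 c4.
have [y1 l1] := ln_close d1 dl2 e1; have [y2 l2] := ln_close d2 dl2 e2.
have ln2 : 0 < ln 2 :> R by rewrite ln_gt0// ltr1n.
rewrite /pickands -mulrBr normrM gtr0_norm ?invr_gt0//.
rewrite ler_pM2l ?invr_gt0// !ln_div ?posrE//.
move: l1 l2; set A := ln _; set B := ln _; set C := ln _; set D := ln _ => l1 l2.
have -> : A - C - (B - D) = (A - B) - (C - D) by lra.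
by apply: le_trans (ler_normB _ _) _; lra.
Qed.

End perturbation.

(** * A Chernoff bound for mixtures of product laws *)

Lemma expR_le_quadratic {R : realType} (x : R) :
  x <= 2^-1 -> expR x <= 1 + x + 2 * x ^+ 2.
Proof.
move=> x2.
have h : expR x <= (1 - x)^-1.
  rewrite -[expR x]invrK -expRN lef_pV2 ?posrE ?expR_gt0//; last lra.
  exact: expR_ge1Dx.
apply: le_trans h _; rewrite -div1r ler_pdivrMr; last lra.
by have := sqr_ge0 x; nra.
Qed.

Lemma measurable_lt_set {R : realType} d (T : measurableType d) (f g : T -> R) :
  measurable_fun setT f -> measurable_fun setT g -> measurable [set w | f w < g w].
Proof.
by move=> mf mg; rewrite -[X in measurable X]setTI; exact: measurable_fun_ltr.
Qed.

Lemma measurable_le_set {R : realType} d (T : measurableType d) (f g : T -> R) :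
  measurable_fun setT f -> measurable_fun setT g -> measurable [set w | f w <= g w].
Proof.
by move=> mf mg; rewrite -[X in measurable X]setTI; exact: measurable_fun_ler.
Qed.

Section chernoff.
Context {R : realType} d (T : measurableType d) (P : probability T R).
Local Open Scope ereal_scope.

Lemma measure_bigsetU_le (I : Type) (r : seq I) (Q : pred I) (B : I -> set T) :
  (forall i, measurable (B i)) ->
  P (\big[setU/set0]_(i <- r | Q i) B i) <= \sum_(i <- r | Q i) P (B i).
Proof.
move=> mB; elim: r => [|i r IH]; first by rewrite !big_nil measure0.
rewrite !big_cons; case: ifP => // _.
apply: le_trans (measureU2 _ _ _) _ => //; first exact: bigsetU_measurable.
exact: leeD.
Qed.

Lemma measurable_natr (f : T -> nat) : measurable_fun setT f ->
  measurable_fun setT (fun w => (f w)%:R : R)%R.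
Proof. by move=> mf _ Y mY; exact: (mf measurableT ((fun n => n%:R%R) @^-1` Y)). Qed.

(** On H, the family (X i) is a mixture of products of the laws p i w, where w
    is distributed according to P. *)
Variables (I : finType) (X : I -> T -> nat) (p : I -> T -> nat -> R) (H : set T).
Hypothesis mX : forall i, measurable_fun setT (X i).
Hypothesis mH : measurable H.
Hypothesis mp : forall i b, measurable_fun H (p i ^~ b).
Hypothesis p0 : forall i w b, (0 <= p i w b)%R.
Hypothesis joint : forall b : I -> nat,
  P (H `&` \bigcap_i (X i @^-1` [set b i])) =
  \int[P]_(w in H) (\prod_i p i w (b i))%R%:E.

Let S w : R := (\sum_i X i w)%N%:R%R.

Let mS : measurable_fun setT S.
Proof.
rewrite (_ : S = fun w => \sum_i (X i w)%:R)%R; last first.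
  by apply/funext => w; rewrite /S natr_sum.
by apply: measurable_sum => i; exact: measurable_natr.
Qed.

Let mtrunc (s y : R) N :
  measurable (H `&` [set w | y <= s * S w]%R `&` \bigcap_i [set w | (X i w < N)%N]).
Proof.
apply: measurableI; first apply: measurableI => //.
  rewrite -[X in measurable X]setTI.
  apply: (@measurable_fun_ler _ _ _ setT (cst y) (fun w => s * S w)%R) => //.
  exact: measurable_funM.
apply: fin_bigcap_measurable => // i _.
have := mX i measurableT (Y := [set n | (n < N)%N]) Logic.I; rewrite setTI; exact.
Qed.

(** Restricting the X i to values below N makes the exponential Markov inequality
    a finite sum over the possible values b of the family: each such value
    carries a factor exp (s sum b - y) >= 1, and the sum of products so obtained
    factors as the product of the truncated moment generating functions. *)
Lemma chernoff_trunc (s y v : R) N :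
  (forall w, H w -> \prod_i \sum_(b < N) expR (s * b%:R) * p i w b <= expR v)%R ->
  P (H `&` [set w | y <= s * S w]%R `&` \bigcap_i [set w | (X i w < N)%N]) <=
  (expR (v - y))%:E * P H.
Proof.
move=> mgf.
pose E (b : {ffun I -> 'I_N}) := H `&` \bigcap_i (X i @^-1` [set (b i : nat)]).
pose Q (b : {ffun I -> 'I_N}) := (y <= s * (\sum_i b i)%N%:R)%R.
have mE b : measurable (E b).
  apply: measurableI => //; apply: fin_bigcap_measurable => // i _.
  by have := mX i measurableT (Y := [set (b i : nat)]) Logic.I; rewrite setTI.
have mpr (b : {ffun I -> 'I_N}) : measurable_fun H (fun w => \prod_i p i w (b i))%R.
  by apply: measurable_prod => i _; exact: mp.
pose g (b : {ffun I -> 'I_N}) w : R :=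
  (expR (- y) * \prod_i (expR (s * (b i)%:R) * p i w (b i)))%R.
have mg b : measurable_fun H (g b).
  apply: measurable_funM => //; apply: measurable_prod => i _.
  exact: measurable_funM.
have g0 b w : (0 <= g b w)%R.
  by rewrite mulr_ge0 ?expR_ge0// prodr_ge0// => i _; rewrite mulr_ge0 ?expR_ge0.
apply: (@le_trans _ _ (P (\big[setU/set0]_(b | Q b) E b))).
  apply: le_measure; rewrite ?inE//; first exact: bigsetU_measurable.
  move=> w [[Hw yS] XN].
  pose b := [ffun i => Ordinal (XN i Logic.I)].
  have Qb : Q b.
    by rewrite /Q (eq_bigr (fun i => X i w)) // => i _; rewrite ffunE.
  rewrite -bigcup_seq_cond; exists b; first by rewrite /= mem_index_enum Qb.
  by split=> // i _ /=; rewrite ffunE.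
apply: le_trans (measure_bigsetU_le _ _ mE) _.
apply: (@le_trans _ _ (\sum_b \int[P]_(w in H) (g b w)%:E)).
  rewrite [leLHS]big_mkcond /=; apply: lee_sum => b _; case: ifP => [Qb|_]; last first.
    by apply: integral_ge0 => w _; rewrite lee_fin.
  rewrite joint; apply: ge0_le_integral => //.
  - by move=> w _; rewrite lee_fin prodr_ge0.
  - exact/measurable_EFinP.
  - exact/measurable_EFinP.
  - move=> w _; rewrite lee_fin /g big_split /= mulrA -[leLHS]mul1r.
    apply: ler_wpM2r; first by rewrite prodr_ge0.
    rewrite -expR_sum -expRD -[leLHS]expR0 ler_expR -mulr_sumr -natr_sum.
    by rewrite addrC subr_ge0.
rewrite -ge0_integral_sum //; last 2 first.
  by move=> b; exact/measurable_EFinP.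
  by move=> b w _; rewrite lee_fin.
rewrite -integral_cst//; apply: ge0_le_integral => //.
- by move=> w _; rewrite sume_ge0// => b _; rewrite lee_fin.
- by apply: emeasurable_sum => b; exact/measurable_EFinP.
- move=> w Hw; rewrite sumEFin lee_fin /g -mulr_sumr /= expRD mulrC.
  apply: ler_wpM2r; first exact: expR_ge0.
  by apply: le_trans (mgf _ Hw); rewrite bigA_distr_bigA.
Qed.

(** The sign of s is free: s > 0 bounds the upper tail of the sum, s < 0 the lower
    tail. *)
Lemma chernoff (s y v : R) :
  (forall N w, H w -> \prod_i \sum_(b < N) expR (s * b%:R) * p i w b <= expR v)%R ->
  P (H `&` [set w | y <= s * S w]%R) <= (expR (v - y))%:E * P H.
Proof.
move=> mgf; set E := _ `&` _.
pose F N := E `&` \bigcap_i [set w | (X i w < N)%N].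
have EF : E = \bigcup_N F N.
  apply/seteqP; split => [w Ew|w [N _ []//]].
  exists (\max_i X i w).+1 => //; split=> // i _ /=.
  by rewrite ltnS; exact: leq_bigmax.
have cF : P \o F @ \oo --> P E.
  rewrite EF; apply: nondecreasing_cvg_mu.
  - by move=> N; exact: mtrunc.
  - by apply: bigcup_measurable => N _; exact: mtrunc.
  - apply/nondecreasing_seqP => N; rewrite subsetEset => w [Ew XN]; split=> // i _ /=.
    exact: leqW (XN i Logic.I).
apply: (cvge_to_le cF); apply: nearW => N /=; exact: chernoff_trunc (mgf N).
Qed.

End chernoff.

(** * The laws of the entries *)

Section laws.
Context {R : realType}.
Implicit Types (r s : R) (N b : nat).

Lemma exp_partial_sum (x : R) N : 0 <= x ->
  \sum_(b < N) x ^+ b / b`!%:R <= expR x.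
Proof.
move=> x0.
have := @nondecreasing_cvgn_le R (series (exp_coeff x)) _ (is_cvg_series_exp_coeff x) N.
rewrite /series /= big_mkord; apply.
apply/nondecreasing_seqP => m; rewrite /series /= big_nat_recr//= lerDl.
by rewrite /exp_coeff /= divr_ge0// exprn_ge0.
Qed.

(** The exponential moments of [law r], for r in D, are at most those of the
    Poisson distribution of mean r. The domain D keeps away from the parameters
    at which a law takes a default value or is truncated. Partial sums over
    b < N avoid any summability question. *)
Definition subpoissonian_law (D : set R) (law : R -> set nat -> \bar R) : Prop :=
  [/\ forall r b, law r [set b] \is a fin_num,
      forall r b, (0 <= law r [set b])%E &
      forall r s N, D r ->
        \sum_(b < N) expR (s * b%:R) * fine (law r [set (b : nat)]) <=
        expR (r * (expR s - 1))].

Lemma poisson_subpoissonian :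
  subpoissonian_law [set r | 0 < r] (fun r => poisson_prob r 0).
Proof.
split=> [r b|r b|r s N /= r0].
- exact: (fin_num_measure (poisson_prob r 0)).
- exact: measure_ge0.
- have -> : \sum_(b < N) expR (s * b%:R) * fine (poisson_prob r 0 [set (b : nat)]) =
     expR (- r) * \sum_(b < N) (r * expR s) ^+ b / b`!%:R.
    rewrite mulr_sumr; apply: eq_bigr => b _.
    rewrite /poisson_prob r0 esum_set1/= ?lee_fin ?poisson_pmf_ge0//.
    rewrite /poisson_pmf r0 expRM_natr exprMn; ring.
  rewrite mulrBr mulr1 addrC expRD; apply: ler_wpM2l; first exact: expR_ge0.
  by apply: exp_partial_sum; rewrite mulr_ge0 ?expR_ge0// ltW.
Qed.

Lemma bernoulli_nat_massE r b : 0 <= r <= 1 ->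
  bernoulli_prob (Num.min r 1) (nat_of_bool @^-1` [set b]) =
  (r * (b == 1%N)%:R + (1 - r) * (b == 0%N)%:R)%:E.
Proof.
move=> r01; have -> : Num.min r 1 = r by apply/min_idPl; lra.
have in1 (c : bool) : (c \in nat_of_bool @^-1` [set b]) = (b == nat_of_bool c).
  by apply/idP/idP => [|/eqP ->]; rewrite inE //= => <-.
by rewrite bernoulli_probE// !diracE !in1.
Qed.

Lemma bernoulli_subpoissonian :
  subpoissonian_law [set r | 0 <= r <= 1]
    (fun r B => bernoulli_prob (Num.min r 1) (nat_of_bool @^-1` B)).
Proof.
split=> [r b|r b|r s N /= r01].
- exact: (fin_num_measure (bernoulli_prob (Num.min r 1))).
- exact: measure_ge0.
- pose t b := expR (s * b%:R) * (r * (b == 1%N)%:R + (1 - r) * (b == 0%N)%:R).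
  have t0 b : 0 <= t b by rewrite mulr_ge0 ?expR_ge0// addr_ge0// mulr_ge0//; lra.
  rewrite (eq_bigr (fun b : 'I_N => t b)); last by move=> b _; rewrite bernoulli_nat_massE.
  apply: (@le_trans _ _ (\sum_(b < N.+2) t b)).
    by rewrite 2!big_ord_recr /= -addrA lerDl addr_ge0.
  rewrite 2!big_ord_recl /= big1 ?addr0 => [|b _]; last by rewrite /t/= !mulr0 addr0 mulr0.
  rewrite /t /= !mulr0 !mulr1 expR0 add0r addr0 mul1r.
  apply: le_trans (expR_ge1Dx _).
  by rewrite mulrBr; lra.
Qed.

End laws.

(** * Degrees given the weights *)

Section graph.
Context {R : realType} d (T : measurableType d) (P : probability T R) (n : nat).
Variables (law : R -> set nat -> \bar R) (D : set R).
Hypothesis law_ok : subpoissonian_law D law.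
Variables (W : 'I_n -> {RV P >-> R}) (A : 'I_n -> 'I_n -> {RV P >-> nat}).
Hypothesis graphA : ordered_random_graph law W A.

Let Word (i : 'I_n) (w : T) : R := ord_stat (fun j => W j w) i.+1.
Let L w := \sum_(i < n) W i w.
Let G := g_sigma_preimage Word.
Let rate i j w := Word i w * Word j w / L w.

Let mWord i : measurable_fun setT (Word i).
Proof. by apply: measurable_ord_stat. Qed.

Lemma preimage_sigma_weights (i : 'I_n) (B : set R) : measurable B -> G (Word i @^-1` B).
Proof.
move=> mB; apply: sub_sigma_algebra; rewrite -bigcup_seq.
by exists i; [rewrite /= mem_index_enum | exists B => //; rewrite setTI].
Qed.

Lemma sigma_weights_measurable H : G H -> measurable H.
Proof.
apply: smallest_sub => [|B]; first exact: sigma_algebra_measurable.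
rewrite -bigcup_seq => -[i _ [C mC <-]]; exact: mWord.
Qed.

Lemma sigma_weightsI H1 H2 : G H1 -> G H2 -> G (H1 `&` H2).
Proof. exact: (@measurableI _ (g_sigma_algebraType _)). Qed.

Lemma edge_subproof (i j : 'I_n) :
  let e := if (i <= j)%N then (i, j) else (j, i) in (e.1 <= e.2)%N.
Proof. by case: (leqP i j) => //= /ltnW. Qed.

(** Entries are indexed by pairs in increasing order, so the row of a node i runs
    over both pairs (i, j) and pairs (j, i). *)
Definition edge (i j : 'I_n) : {e : 'I_n * 'I_n | (e.1 <= e.2)%N} :=
  exist (fun e : 'I_n * 'I_n => is_true (e.1 <= e.2)%N) _ (edge_subproof i j).

Definition other_end (i : 'I_n) (e : {e : 'I_n * 'I_n | (e.1 <= e.2)%N}) : 'I_n :=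
  if (val e).1 == i then (val e).2 else (val e).1.

Lemma edgeK i : cancel (edge i) (other_end i).
Proof.
move=> j; rewrite /other_end /=; case: (leqP i j) => /= ij; first by rewrite eqxx.
by rewrite -val_eqE ltn_eqF.
Qed.

Let A_sym i j : (A i j : T -> nat) = A j i.
Proof. by apply/funext => w; have [-> _ _] := graphA. Qed.

Lemma A_edge i j : (A (val (edge i j)).1 (val (edge i j)).2 : T -> nat) = A i j.
Proof. by rewrite /=; case: (leqP i j) => //= _; exact: A_sym. Qed.

Lemma rateC i j w : rate i j w = rate j i w.
Proof. by rewrite /rate [Word i w * _]mulrC. Qed.

Let cond_edge i j (B : set nat) :
  is_cond_prob P G (A i j @^-1` B) (fun w => law (rate i j w) B).
Proof.
have [_ _ h] := graphA; have [ij|/ltnW ji] := leqP i j; first exact: h.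
rewrite A_sym; under [X in is_cond_prob _ _ _ X]funext do rewrite rateC; exact: h.
Qed.

Lemma measurable_edge_law i j b :
  measurable_fun setT (fun w => fine (law (rate i j w) [set b])).
Proof.
apply: (measurableT_comp (f := fine)) => // _ B mB; rewrite setTI.
by apply: sigma_weights_measurable; apply (cond_edge i j [set b]).1.
Qed.

(** The entries of a row involve distinct unordered pairs, hence they are
    conditionally independent; integrating over an event H that depends on the
    weights only gives their joint law on H. *)
Lemma joint_row i H (b : 'I_n -> nat) : G H ->
  P (H `&` \bigcap_j (A i j @^-1` [set b j])) =
  (\int[P]_(w in H) (\prod_j fine (law (rate i j w) [set b j]))%:E)%E.
Proof.
move=> GH; have [_ indep _] := graphA.
pose J : {set {e : 'I_n * 'I_n | (e.1 <= e.2)%N}} := (edge i @: [set: 'I_n])%SET.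
pose f (e : {e : 'I_n * 'I_n | (e.1 <= e.2)%N}) w : \bar R :=
  law (rate (val e).1 (val e).2 w) [set b (other_end i e)].
have [|e _|_ /(_ H GH)] := indep J (fun e => [set b (other_end i e)]) f.
- by [].
- exact: cond_edge.
rewrite (_ : \bigcap_(e in _) _ = \bigcap_j (A i j @^-1` [set b j])); last first.
  apply/seteqP; split => w wA.
    move=> j _; have : edge i j \in J by apply: imset_f; rewrite inE.
    by move=> /(wA (edge i j)); rewrite /preimage /mkset edgeK A_edge.
  move=> _ /= /imsetP[j _ ->]; rewrite edgeK A_edge; exact: wA.
rewrite setIC => <-.
apply: eq_integral => w _; rewrite big_imset /=; last first.
  by move=> j j' _ _ /(congr1 (other_end i)); rewrite !edgeK.
rewrite -prodEFin; apply: eq_big => [j|j _]; first by rewrite inE.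
rewrite fineK; last by case: law_ok.
rewrite /f edgeK; congr (law _ _).
by rewrite /=; case: (leqP i j) => // _; rewrite rateC.
Qed.

Lemma measurable_degree i : measurable_fun setT (fun w => degree A i w).
Proof.
rewrite (_ : (fun w => _) = fun w => \sum_j (A i j w)%:R); last first.
  by apply/funext => w; rewrite /degree natr_sum.
by apply: measurable_sum => j; exact: measurable_natr.
Qed.

Lemma sum_rate i w : L w != 0 -> \sum_j rate i j w = Word i w.
Proof.
move=> L0; rewrite /rate -mulr_suml -mulr_sumr /Word sum_ord_stat -/(L w).
by rewrite mulfK.
Qed.

(** The means of the entries of a row add up to the weight, so the product of
    their Poisson bounds is the bound for a Poisson variable of that mean. *)
Lemma degree_chernoff i H s y v : G H ->
  (forall w j, H w -> D (rate i j w)) -> (forall w, H w -> L w != 0) ->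
  (forall w, H w -> (expR s - 1) * Word i w <= v) ->
  (P (H `&` [set w | y <= s * degree A i w]%R) <= (expR (v - y))%:E * P H)%E.
Proof.
move=> GH HD HL Hv; have [lawfin law0 lawmgf] := law_ok.
apply: (@chernoff _ _ _ P _ (A i) (fun j w b => fine (law (rate i j w) [set b]))) => //.
- exact: sigma_weights_measurable.
- by move=> j b; apply: measurable_funTS; exact: measurable_edge_law.
- by move=> j w b; exact: fine_ge0.
- by move=> b; exact: joint_row.
move=> N w Hw.
apply: (@le_trans _ _ (\prod_j expR (rate i j w * (expR s - 1)))).
  apply: ler_prod => j _; apply/andP; split; last by apply: lawmgf; exact: HD.
  by apply: sumr_ge0 => b _; rewrite mulr_ge0 ?expR_ge0 ?fine_ge0.
rewrite -expR_sum ler_expR -mulr_suml sum_rate ?HL// mulrC; exact: Hv.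
Qed.

(** [cell i H l] fixes the weight of node i up to an error of 1, by an event of the
    sigma-algebra of the weights. *)
Let cell i H (l : nat) := H `&` Word i @^-1` `[l%:R, l.+1%:R[%classic.

(** The cells partition H, so that bounds proportional to their probabilities
    add up. *)
Lemma cell_union_bound i H (E : set T) (c : R) : G H -> measurable E ->
  (forall w, H w -> 0 <= Word i w) -> 0 <= c ->
  (forall l, (P (cell i H l `&` E) <= c%:E * P (cell i H l))%E) ->
  (P (H `&` E) <= c%:E)%E.
Proof.
move=> GH mE H0 c0 HC.
pose C := cell i H.
have mC l : measurable (C l).
  apply: sigma_weights_measurable; apply: sigma_weightsI => //.
  exact: preimage_sigma_weights.
have HE : H = \bigcup_l C l.
  apply/seteqP; split => [w Hw|w [l _ []//]].
  exists (Num.truncn (Word i w)) => //; split=> //.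
  by rewrite /= in_itv/= truncn_le ?truncnS_gt ?H0.
have tC : trivIset setT C.
  apply/trivIsetP => a b _ _ ab; apply/seteqP; split => // w [[_]] + [_].
  rewrite /= !in_itv/= => /andP[a1 a2] /andP[b1 b2].
  have := le_lt_trans a1 b2; have := le_lt_trans b1 a2; rewrite !ltr_nat; lia.
have mH : measurable H by exact: sigma_weights_measurable.
apply: (@le_trans _ _ (\sum_(0 <= l <oo) P (C l `&` E))%E).
  apply: measure_sigma_subadditive => //.
  - by move=> l; exact: measurableI.
  - exact: measurableI.
  - by rewrite {1}HE setI_bigcupl.
apply: (@le_trans _ _ (\sum_(0 <= l <oo) c%:E * P (C l))%E).
  by apply: lee_nneseries => // l _; exact: HC.
rewrite nneseriesZl// -measure_semi_bigcup//; last by rewrite -HE.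
by rewrite -HE -[leRHS]mule1; apply: lee_wpmul2l => //; exact: probability_le1.
Qed.

Lemma degree_cell_tail i H (E : set T) (l : nat) (s y v : R) :
  G H -> measurable E ->
  (forall w j, H w -> D (rate i j w)) -> (forall w, H w -> L w != 0) ->
  (forall w, H w -> l%:R <= Word i w < l.+1%:R -> E w -> y <= s * degree A i w) ->
  (forall x, l%:R <= x < l.+1%:R -> (expR s - 1) * x <= v) ->
  (P (cell i H l `&` E) <= (expR (v - y))%:E * P (cell i H l))%E.
Proof.
move=> GH mE HD HL HE Hv; set C := cell i H l.
have GC : G C by apply: sigma_weightsI => //; exact: preimage_sigma_weights.
have inC w : C w -> H w /\ l%:R <= Word i w < l.+1%:R.
  by move=> [Hw]; rewrite /= in_itv.
apply: le_trans (degree_chernoff (s := s) y (v := v) GC _ _ _).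
- apply: le_measure; rewrite ?inE.
  + by apply: measurableI => //; exact: sigma_weights_measurable.
  + apply: measurableI; first exact: sigma_weights_measurable.
    apply: (@measurable_le_set _ _ _ (cst y) (fun w => s * degree A i w)) => //.
    by apply: measurable_funM => //; exact: measurable_degree.
  + by move=> w [Cw Ew]; split=> //; have [Hw lw] := inC w Cw; exact: HE.
- by move=> w j /inC[Hw _]; exact: HD.
- by move=> w /inC[Hw _]; exact: HL.
- by move=> w /inC[Hw lw]; exact: Hv.
Qed.

(** One exponent serves all weights: with s = delta / 4 and M >= m a bound on the
    weight, M (2 s^2 - s delta) = - M delta^2 / 8 <= - m delta^2 / 8. The width 1
    of a cell costs at most the factor exp 1. *)
Lemma degree_upper_tail i H (dl m : R) : G H ->
  (forall w j, H w -> D (rate i j w)) -> (forall w, H w -> L w != 0) ->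
  (forall w, H w -> 0 <= Word i w) -> 0 < dl <= 1 ->
  (P (H `&` [set w | (1 + dl) * Num.max (Word i w) m < degree A i w]%R) <=
   (expR (1 - m * dl ^+ 2 / 8))%:E)%E.
Proof.
move=> GH HD HL H0 dl01.
have mE : measurable [set w | (1 + dl) * Num.max (Word i w) m < degree A i w].
  apply: measurable_lt_set; last exact: measurable_degree.
  apply: measurable_funM => //.
  by apply: measurable_maxr.
apply: (cell_union_bound GH mE H0 (expR_ge0 _)) => l; set C := cell i H l.
set M := Num.max l%:R m.
have Ml : l%:R <= M by rewrite le_max lexx.
have Mm : m <= M by rewrite le_max lexx orbT.
have M0 : 0 <= M by apply: le_trans Ml.
pose s := dl / 4.
have sE : dl = 4 * s by rewrite /s; lra.
have s0 : 0 < s by rewrite /s; lra.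
have s4 : s <= 4^-1 by rewrite /s; lra.
have es := @expR_le_quadratic R s ltac:(lra).
have es1 : 1 <= expR s by rewrite -expR0 ler_expR; lra.
apply: le_trans (degree_cell_tail (s := s) (y := s * ((1 + dl) * M))
  (v := (expR s - 1) * l.+1%:R) GH mE HD HL _ _) _.
- move=> w Hw /andP[lW _] /= Dw; rewrite ler_pM2l//.
  apply: le_trans (ltW Dw); apply: ler_wpM2l; first lra.
  by rewrite ge_max le_max lW/= le_max lexx orbT.
- by move=> x /andP[_ /ltW]; apply: ler_wpM2l; lra.
apply: lee_wpmul2r => //; rewrite lee_fin ler_expR -natr1.
have : (expR s - 1) * (l%:R + 1) <= (s + 2 * s ^+ 2) * (M + 1).
  have l0 : 0 <= l%:R :> R by [].
  by apply: ler_pM; lra.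
have : m * s ^+ 2 <= M * s ^+ 2 by apply: ler_wpM2r => //; exact: sqr_ge0.
have : s ^+ 2 <= 4^-1 * s by rewrite expr2 ler_pM2r.
rewrite sE; move: (expR s) => e; rewrite !expr2; nra.
Qed.

Lemma degree_lower_tail i H (dl m : R) : G H ->
  (forall w j, H w -> D (rate i j w)) -> (forall w, H w -> L w != 0) ->
  (forall w, H w -> 0 <= Word i w) -> 0 < dl <= 1 ->
  (P (H `&` [set w | m <= Word i w /\ degree A i w < (1 - dl) * Word i w]%R) <=
   (expR (1 - m * dl ^+ 2 / 8))%:E)%E.
Proof.
move=> GH HD HL H0 dl01.
have mE : measurable [set w | m <= Word i w /\ degree A i w < (1 - dl) * Word i w].
  apply: measurableI; first exact: measurable_le_set.
  apply: measurable_lt_set; first exact: measurable_degree.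
  exact: measurable_funM.
apply: (cell_union_bound GH mE H0 (expR_ge0 _)) => l; set C := cell i H l.
pose s := dl / 4.
have sE : dl = 4 * s by rewrite /s; lra.
have s0 : 0 < s by rewrite /s; lra.
have s4 : s <= 4^-1 by rewrite /s; lra.
have es := @expR_le_quadratic R (- s) ltac:(lra).
have es1 : expR (- s) <= 1 by rewrite -expR0 ler_expR; lra.
have [lm|ml] := leP l.+1%:R m.
  (* Below the level m the event is empty. *)
  rewrite (_ : C `&` _ = set0) ?measure0 ?mule_ge0//.
  apply/seteqP; split=> // w [[_]]; rewrite /= in_itv/= => /andP[_ Wl] [mW _].
  by have := lt_le_trans Wl (le_trans lm mW); rewrite ltxx.
apply: le_trans (degree_cell_tail (s := - s) (y := - s * ((1 - dl) * l.+1%:R))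
  (v := (expR (- s) - 1) * l%:R) GH mE HD HL _ _) _.
- move=> w Hw /andP[_ /ltW Wl] [_ /= Dw]; rewrite !mulNr lerN2 ler_pM2l//.
  by apply: le_trans (ltW Dw) _; apply: ler_wpM2l => //; lra.
- by move=> x /andP[lx _]; apply: ler_wnM2l => //; lra.
apply: lee_wpmul2r => //; rewrite lee_fin ler_expR; move: ml; rewrite -natr1 => ml.
have l0 : 0 <= l%:R :> R by [].
have : (expR (- s) - 1) * l%:R <= (- s + 2 * s ^+ 2) * l%:R.
  by apply: ler_wpM2r => //; move: es; rewrite sqrrN; lra.
have : (m - 1) * s ^+ 2 <= l%:R * s ^+ 2 by apply: ler_wpM2r; [exact: sqr_ge0|lra].
have : s ^+ 2 <= 4^-1 * s by rewrite expr2 ler_pM2r.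
rewrite sE; move: (expR (- s)) => e; rewrite !expr2; nra.
Qed.

End graph.

(** * The tail quantile function *)

Section quantile.
Context {R : realType}.
Variables (F : R -> R).
Hypothesis F_df : distribution_function F.
Hypothesis F_cont : continuous F.
Hypothesis F_supp : forall x : R, x <= 0 -> F x = 0.
Let U := tail_quantile F.

Lemma df_homo : {homo F : x y / x <= y}.
Proof. by have [] := F_df. Qed.

Lemma df_ge0 x : 0 <= F x.
Proof.
have [x0|/ltW x0] := leP x 0; first by rewrite F_supp.
by rewrite -[0](F_supp (lexx 0)); exact: df_homo.
Qed.

Lemma df_le1 x : F x <= 1.
Proof.
have [_ _ _ F1] := F_df; rewrite leNgt; apply/negP => Fx.
have [M [_ hM]] := cvgr_lt _ F1 _ Fx.
have := hM (Num.max x (M + 1)) ltac:(by rewrite lt_max ltrDl ltr01 orbT).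
by rewrite ltNge => /negP; apply; apply: df_homo; rewrite le_max lexx.
Qed.

Lemma F_tail_quantile t : 1 < t -> F (U t) = 1 - t^-1.
Proof.
move=> t1; have t0 : 0 < t by lra.
set p := 1 - t^-1.
have p0 : 0 < p by rewrite subr_gt0 invf_lt1.
have p1 : p < 1 by rewrite ltrBlDr ltrDl invr_gt0.
have [_ _ _ F1] := F_df.
have [b [b0 pb]] : exists b, 0 <= b /\ p <= F b.
  have [M [_ hM]] := cvgr_ge _ F1 _ p1; exists (Num.max 0 (M + 1)).
  by rewrite le_max lexx; split=> //; apply: hM; rewrite lt_max ltrDl ltr01 orbT.
pose S := [set x | p <= F x].
have S_gt0 x : S x -> 0 < x.
  by move=> px; rewrite ltNge; apply/negP => /F_supp Fx; move: px; rewrite /S/= Fx leNgt p0.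
have [c _ Fc] : exists2 c, c \in `[0, b] & F c = p.
  apply: IVT => //; first by apply: continuous_subspaceT.
  by rewrite F_supp// minElt maxElt; case: ifPn => ? ; lra.
have infS : has_inf S.
  by split; [exists b | exists 0 => x /S_gt0/ltW].
have UE : U t = inf S by [].
rewrite UE; apply/eqP; rewrite eq_le; apply/andP; split.
  by rewrite -Fc; apply: df_homo; apply: ge_inf; [case: infS | rewrite /S/= Fc].
rewrite leNgt; apply/negP => Fp.
have := cvgr_lt _ (@F_cont (inf S)) _ Fp.
case => e /= e0 he.
have [x Sx xlt] := inf_adherent (divr_gt0 e0 (ltr0n R 2)) infS.
have := he (inf S + e / 2); rewrite /ball/= opprD addrA subrr sub0r normrN gtr0_norm ?divr_gt0//.
move=> /(_ ltac:(lra)) lt_p.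
have := le_lt_trans (df_homo (ltW xlt)) lt_p.
by rewrite ltNge => /negP; apply.
Qed.

Lemma tail_quantile_gt0 t : 1 < t -> 0 < U t.
Proof.
move=> t1; have tV : t^-1 < 1 by rewrite invf_lt1//; lra.
by rewrite ltNge; apply/negP => /F_supp; rewrite F_tail_quantile//; lra.
Qed.

Variable gamma : R.
Hypothesis gamma_gt0 : 0 < gamma.
Hypothesis U_lower : exists t0 eta : R, [/\ 0 < t0, 0 <= eta < 1 &
     forall t x : R, t0 <= t -> 1 <= x ->
       (1 - eta) * x `^ gamma + eta <= U (t * x) / U t].

Lemma tail_quantile_growth : exists c t1 : R,
  [/\ 0 < c, 1 < t1 & forall t, t1 <= t -> c * t `^ gamma <= U t].
Proof.
have [t0 [eta [t0_gt0 eta01 Ul]]] := U_lower.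
pose t1 := t0 + 2; have U1 : 0 < U t1 by apply: tail_quantile_gt0; rewrite /t1; lra.
have t1p : 0 < t1 by rewrite /t1; lra.
have p1 : 0 < t1 `^ gamma by exact: powR_gt0.
exists (U t1 * (1 - eta) / t1 `^ gamma), t1; split.
- by rewrite divr_gt0// mulr_gt0//; lra.
- by rewrite /t1; lra.
move=> t tt1.
have tE : t1 * (t / t1) = t by field; rewrite gt_eqF.
have x1 : 1 <= t / t1 by rewrite ler_pdivlMr ?mul1r.
have := Ul t1 (t / t1) ltac:(rewrite /t1; lra) x1.
rewrite ler_pdivlMr// tE; apply: le_trans.
rewrite -[in t `^ gamma]tE powRM ?(ltW t1p)//; last lra.
move: ((t / t1) `^ gamma) (powR_ge0 (t / t1) gamma) => y y0.
have -> : U t1 * (1 - eta) / t1 `^ gamma * (t1 `^ gamma * y) = (1 - eta) * y * U t1.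
  by field; rewrite gt_eqF.
by apply: ler_wpM2r; [exact: ltW|lra].
Qed.

Lemma tail_quantile_gap (x : R) : 1 < x -> exists c t1 : R,
  [/\ 0 < c, 1 < t1 & forall t, t1 <= t -> (1 + c) * U t <= U (x * t)].
Proof.
move=> x1; have [t0 [eta [t0_gt0 eta01 Ul]]] := U_lower.
have xg : 1 < x `^ gamma.
  have := gt0_ltr_powR gamma_gt0 (x := 1) (y := x).
  by rewrite powR1; apply; rewrite ?nnegrE ?in_itv/= ?andbT; lra.
exists ((1 - eta) * (x `^ gamma - 1)), (t0 + 2); split; [nra|lra|].
move=> t tt; have Ut : 0 < U t by apply: tail_quantile_gt0; lra.
have := Ul t x ltac:(lra) (ltW x1); rewrite ler_pdivlMr// [t * x]mulrC.
by apply: le_trans; apply: ler_wpM2r; lra.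
Qed.

End quantile.

(** * Rates of growth *)

Section growth.
Context {R : realType}.

Lemma powR_natr_large (e M : R) : 0 < e -> \forall n \near \oo, M <= n%:R `^ e.
Proof.
move=> e0; near=> n.
have M0 : 0 <= Num.max M 0 by rewrite le_max lexx orbT.
have h : Num.max M 0 `^ e^-1 <= n%:R by near: n; exact: nbhs_infty_ger.
apply: (@le_trans _ _ (Num.max M 0)); first by rewrite le_max lexx.
have -> : Num.max M 0 = (Num.max M 0 `^ e^-1) `^ e.
  by rewrite -powRrM mulVf ?gt_eqF// powRr1.
by apply: ge0_ler_powR; rewrite ?nnegrE ?powR_ge0// ltW.
Unshelve. all: by end_near. Qed.

Lemma ln_natr_large (M : R) : \forall n \near \oo, M <= ln (n%:R : R).
Proof.
near=> n; rewrite -[M]expRK ler_ln ?posrE ?expR_gt0//.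
  by near: n; exact: nbhs_infty_ger.
by rewrite ltr0n; near: n; exact: nbhs_infty_gt.
Unshelve. all: by end_near. Qed.

(** Put b = 1 / (4 alpha + 1). The growth condition gives k (ln n)^alpha <= n^b,
    hence k <= n^b, which is the first claim since b < 1. Multiplied by k^alpha it
    gives k^(1 + alpha) (ln n)^alpha <= n^((1 + alpha) b), where (1 + alpha) b < 1;
    the power 1 / alpha of this inequality gives the second claim. *)
Lemma rank_rate_growth (alpha : R) (k : nat -> nat) : 0 < alpha ->
  (forall n, (0 < k n)%N) ->
  (k n)%:R * ln (n%:R : R) `^ alpha / n%:R `^ (1 / (4 * alpha + 1)) @[n --> \oo] --> (0 : R) ->
  forall M : R, \forall n \near \oo,
    M * (k n)%:R <= n%:R /\
    M * ((k n)%:R * ln (n%:R : R)) <= (n%:R / (k n)%:R) `^ (1 / alpha).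
Proof.
move=> a0 k0 kr M; set be := 1 / (4 * alpha + 1) in kr.
have beE : be * (4 * alpha + 1) = 1 by rewrite /be; field; rewrite gt_eqF//; lra.
have be0 : 0 < be by rewrite /be divr_gt0//; lra.
have be1 : be < 1 by nra.
pose e := (1 - (1 + alpha) * be) / alpha.
have e0 : 0 < e by rewrite /e divr_gt0//; nra.
near=> n.
have n1 : 1 < n%:R :> R by rewrite ltr1n; near: n; exact: nbhs_infty_gt.
have n0 : 0 < n%:R :> R by lra.
have nbe : 0 < n%:R `^ be by exact: powR_gt0.
have kR : 0 < (k n)%:R :> R by rewrite ltr0n.
have ln1 : 1 <= ln (n%:R : R) by near: n; exact: ln_natr_large.
have lna : 1 <= ln (n%:R : R) `^ alpha.
  by have := ler_powR ln1 (ltW a0); rewrite powRr0.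
have : (k n)%:R * ln (n%:R : R) `^ alpha / n%:R `^ be <= 1.
  by near: n; exact: (cvgr_le _ kr _ ltr01).
rewrite ler_pdivrMr// => kl; rewrite mul1r in kl.
have kn : (k n)%:R <= n%:R `^ be :> R.
  by apply: le_trans kl; rewrite ler_peMr// ltW.
split.
  have : M <= n%:R `^ (1 - be) by near: n; apply: powR_natr_large; lra.
  move=> Mn; apply: (@le_trans _ _ (n%:R `^ (1 - be) * n%:R `^ be)).
    apply: (@le_trans _ _ (n%:R `^ (1 - be) * (k n)%:R)).
      by apply: ler_wpM2r.
    by apply: ler_wpM2l => //; exact: powR_ge0.
  by rewrite -powRD ?(gt_eqF n0) ?implybT// subrK powRr1// ltW.
have Me : M <= n%:R `^ e by near: n; exact: powR_natr_large.
have ia : 0 <= 1 / alpha by rewrite divr_ge0// ltW.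
have [q qE] : exists q, q = (1 + alpha) * be / alpha by exists ((1 + alpha) * be / alpha).
have key : (k n)%:R * ln n%:R * (k n)%:R `^ (1 / alpha) <= n%:R `^ q.
  have -> : (k n)%:R * ln n%:R * (k n)%:R `^ (1 / alpha) =
      ((k n)%:R `^ alpha * ((k n)%:R * ln (n%:R : R) `^ alpha)) `^ (1 / alpha).
    rewrite !powRM ?mulr_ge0 ?powR_ge0//.
    rewrite -!powRrM !(mulrC alpha) divfK ?gt_eqF// !powRr1//; last lra.
    by ring.
  rewrite (_ : q = (be * alpha + be) * (1 / alpha)); last by rewrite qE; lra.
  rewrite [X in _ <= X]powRrM.
  apply: ge0_ler_powR; rewrite ?nnegrE ?mulr_ge0 ?powR_ge0 ?invr_ge0 ?(ltW a0)//.
  rewrite powRD ?(gt_eqF n0) ?implybT// powRrM; apply: ler_pM; rewrite ?mulr_ge0 ?powR_ge0//.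
  by apply: ge0_ler_powR; rewrite ?nnegrE ?powR_ge0// ltW.
have kg : 0 < (k n)%:R `^ (1 / alpha) by exact: powR_gt0.
rewrite -(ler_pM2r kg) -powRM ?divr_ge0 ?(ltW n0) ?(ltW kR)// divfK ?gt_eqF//.
apply: (@le_trans _ _ (n%:R `^ e * n%:R `^ q)).
  rewrite -mulrA.
  apply: (@le_trans _ _ (n%:R `^ e * ((k n)%:R * ln n%:R * (k n)%:R `^ (1 / alpha)))).
    by apply: ler_wpM2r => //; rewrite !mulr_ge0 ?powR_ge0//; lra.
  by apply: ler_wpM2l; [exact: powR_ge0|exact: key].
rewrite -powRD ?(gt_eqF n0) ?implybT//.
by rewrite (_ : e + _ = 1 / alpha)//; rewrite qE /e; field; rewrite gt_eqF.
Unshelve. all: by end_near. Qed.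

End growth.

Section tail.
Context {R : realType}.
Variables (F : R -> R).
Hypothesis F_df : distribution_function F.
Hypothesis F_cont : continuous F.
Hypothesis F_supp : forall x : R, x <= 0 -> F x = 0.
Let U := tail_quantile F.

(** Any exponent g above gamma absorbs the error term of the limit of
    U(2t) / U(t); iterating the doubling gives a bound of Potter type. *)
Lemma tail_quantile_doubling (gamma g : R) : gamma < g ->
  U (t * 2) / U t @[t --> +oo] --> 2 `^ gamma ->
  exists t1, 1 < t1 /\ forall t, t1 <= t -> U (2 * t) <= 2 `^ g * U t.
Proof.
move=> gg cvU.
have g2 : 2 `^ gamma < 2 `^ g.
  rewrite /powR; case: ifPn => [|_]; first by rewrite pnatr_eq0.
  by rewrite ltr_expR ltr_pM2r// ln_gt0// ltr1n.
have [M [_ hM]] := cvgr_lt _ cvU _ g2.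
exists (Num.max M 1 + 1); split; first by rewrite ltrDr lt_max ltr01 orbT.
move=> t tM.
have [Mt t1] : M < t /\ 1 < t.
  have m1 : M <= Num.max M 1 by rewrite le_max lexx.
  have m2 : 1 <= Num.max M 1 by rewrite le_max lexx orbT.
  by split; lra.
have Ut : 0 < U t by exact: (tail_quantile_gt0 F_df F_cont F_supp).
by rewrite -ler_pdivrMr// [2 * t]mulrC ltW// hM.
Qed.

(** If 2^(j g) <= x / U(t1) < 2^((j + 1) g), then x is above the quantile
    U(2^j t1), which leaves a tail of mass at most 2^-j. *)
Lemma df_tail_bound (g : R) : 0 < g ->
  (exists t1, 1 < t1 /\ forall t, t1 <= t -> U (2 * t) <= 2 `^ g * U t) ->
  exists C x0, [/\ 0 < C, 0 < x0 & forall x, x0 <= x -> 1 - F x <= C * x `^ (- g^-1)].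
Proof.
move=> g0 [t1 [t11 dbl]].
have U1 : 0 < U t1 by exact: (tail_quantile_gt0 F_df F_cont F_supp).
have t1p : 0 < t1 by lra.
pose b : R := 2 `^ g.
have b1 : 1 < b.
  rewrite /b /powR; case: ifPn => [|_]; first by rewrite pnatr_eq0.
  by rewrite expR_gt1 mulr_gt0// ln_gt0// ltr1n.
have Uj j : U (2 ^+ j * t1) <= b ^+ j * U t1.
  elim: j => [|j IH]; first by rewrite !expr0 !mul1r.
  rewrite !exprS -!mulrA; apply: le_trans (dbl _ _) _.
    by rewrite ler_peMl ?exprn_ege1 ?ler1n ?(ltW t1p).
  by apply: ler_wpM2l => //; exact: powR_ge0.
exists (2 * U t1 `^ g^-1), (U t1); split => //.
  by rewrite mulr_gt0// powR_gt0.
move=> x xU.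
have x0 : 0 < x by exact: lt_le_trans xU.
pose y := x / U t1.
have y1 : 1 <= y by rewrite ler_pdivlMr// mul1r.
have lnb : 0 < ln b by exact: ln_gt0.
have lny : 0 <= ln y by exact: ln_ge0.
have y0 : 0 < y by lra.
have b0 : 0 < b by lra.
have q0 : 0 <= ln y / ln b by rewrite divr_ge0// ltW.
have [j [jl jr]] : exists j, b ^+ j <= y /\ y <= b ^+ j.+1.
  exists (Num.truncn (ln y / ln b)); split; rewrite -ler_ln ?posrE ?exprn_gt0// lnXn//.
    by rewrite -mulr_natl -ler_pdivlMr// truncn_le.
  by rewrite -mulr_natl -ler_pdivrMr// ltW// truncnS_gt.
have tj : 1 < 2 ^+ j * t1.
  by apply: lt_le_trans t11 _; rewrite ler_peMl ?exprn_ege1 ?ler1n ?(ltW t1p).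
have Fj : 1 - F x <= (2 ^+ j * t1)^-1.
  have : F (U (2 ^+ j * t1)) <= F x.
    apply: (df_homo F_df); apply: le_trans (Uj j) _.
    by rewrite -ler_pdivlMr.
  rewrite (F_tail_quantile F_df F_cont F_supp tj); lra.
apply: le_trans Fj _.
have yg : y `^ g^-1 <= 2 ^+ j.+1.
  have -> : 2 ^+ j.+1 = (b ^+ j.+1) `^ g^-1.
    rewrite /b -!powR_mulrn ?powR_ge0// -!powRrM; congr (_ `^ _).
    by field; rewrite gt_eqF.
  apply: ge0_ler_powR; rewrite ?nnegrE ?invr_ge0 ?(ltW g0)// ?exprn_ge0//; lra.
have xE : x `^ g^-1 = y `^ g^-1 * U t1 `^ g^-1.
  by rewrite -powRM ?divfK ?gt_eqF//; lra.
rewrite powRN -div1r ler_pdivrMr ?mulr_gt0 ?exprn_gt0//.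
rewrite mulrAC ler_pdivlMr ?powR_gt0// mul1r xE.
have p0 : 0 < U t1 `^ g^-1 by exact: powR_gt0.
apply: (@le_trans _ _ (2 ^+ j.+1 * U t1 `^ g^-1)); first by apply: ler_wpM2r => //; exact: ltW.
have -> : 2 * U t1 `^ g^-1 * (2 ^+ j * t1) = 2 ^+ j.+1 * U t1 `^ g^-1 * t1.
  by rewrite exprS; ring.
by rewrite ler_peMr ?mulr_ge0 ?exprn_ge0 ?powR_ge0//; lra.
Qed.

(** With g < 1/2 the maximum of n weights is negligible with respect to sqrt n. *)
Lemma df_tail_vanish (g c : R) : 0 < g -> g < 2^-1 -> 0 < c ->
  (exists t1, 1 < t1 /\ forall t, t1 <= t -> U (2 * t) <= 2 `^ g * U t) ->
  n%:R * (1 - F (Num.sqrt (c * n%:R))) @[n --> \oo] --> (0 : R).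
Proof.
move=> g0 g2 c0 dbl; have [C [x0 [C0 x00 tail]]] := df_tail_bound g0 dbl.
pose e := (2 * g)^-1 - 1.
have e0 : 0 < e by rewrite subr_gt0 invf_gt1; lra.
pose K := C * c `^ (- (2 * g)^-1).
have K0 : 0 < K by rewrite mulr_gt0// powR_gt0.
apply/cvgr0Pnorm_lt => eps eps0; near=> n.
have n0 : 0 < n%:R :> R by rewrite ltr0n; near: n; exact: nbhs_infty_gt.
have cn0 : 0 < c * n%:R by rewrite mulr_gt0.
have xn : x0 <= Num.sqrt (c * n%:R).
  rewrite -(ger0_norm (ltW x00)) -sqrtr_sqr ler_sqrt//; last exact: ltW.
  by rewrite mulrC -ler_pdivrMr//; near: n; exact: nbhs_infty_ger.
have ne : K / eps + 1 <= n%:R `^ e by near: n; exact: powR_natr_large.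
have F1 := df_le1 F_df (Num.sqrt (c * n%:R)).
rewrite ger0_norm; last by rewrite mulr_ge0//; lra.
apply: (@le_lt_trans _ _ (K / n%:R `^ e)).
  apply: (@le_trans _ _ (n%:R * (C * Num.sqrt (c * n%:R) `^ (- g^-1)))).
    by apply: ler_wpM2l; [exact: ltW|exact: tail].
  rewrite -powR12_sqrt; last exact: ltW.
  rewrite -powRrM powRM ?(ltW c0) ?(ltW n0)//.
  have -> : 2^-1 * - g^-1 = - (2 * g)^-1 by rewrite invfM; lra.
  rewrite -powRN /K (_ : - e = 1 - (2 * g)^-1); last by rewrite /e; lra.
  rewrite powRD ?(gt_eqF n0) ?implybT// powRr1 ?(ltW n0)//.
  by rewrite le_eqVlt; apply/orP; left; apply/eqP; ring.
rewrite ltr_pdivrMr ?powR_gt0// mulrC -ltr_pdivrMr//; lra.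
Unshelve. all: by end_near. Qed.

End tail.

(** * Order statistics of the weights *)

Section counting.
Context {R : realType} d (T : measurableType d) (P : probability T R) (n : nat).
Variables (F : R -> R) (W : 'I_n -> {RV P >-> R}).
Hypothesis F_df : distribution_function F.
Hypothesis F_cont : continuous F.
Hypothesis F_supp : forall x : R, x <= 0 -> F x = 0.
Hypothesis W_indep : mutual_independence W.
Hypothesis W_cdf : forall i x, cdf (W i) x = (F x)%:E.
Let U := tail_quantile F.

Lemma prob_le_weight i x : P (W i @^-1` [set y | y <= x]) = (F x)%:E.
Proof. by rewrite -(W_cdf i) -set_itvNyc. Qed.

Let mgt x : measurable [set y : R | x < y].
Proof. exact: (measurable_lt_set (f := cst x) (g := id)). Qed.
Let mle x : measurable [set y : R | y <= x].
Proof. exact: (measurable_le_set (f := id) (g := cst x)). Qed.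

Lemma prob_gt_weight i x : P (W i @^-1` [set y | x < y]) = (1 - F x)%:E.
Proof.
have -> : W i @^-1` [set y | x < y] = ~` (W i @^-1` [set y | y <= x]).
  by apply/seteqP; split => w /=; rewrite ltNge => /negP.
rewrite probability_setC ?prob_le_weight//.
by rewrite -[X in measurable X]setTI; apply: (measurable_funPT (W i)) => //.
Qed.

Definition exceedances (x : R) (w : T) : nat := (\sum_(i < n) (x < W i w)%R)%N.

(** Exceedances are independent Bernoulli variables: this is the mixture bound
    on the whole space, with laws that do not depend on the point. *)
Lemma exceedances_chernoff x s y v : (expR s - 1) * (n%:R * (1 - F x)) <= v ->
  (P [set w | (y <= s * (exceedances x w)%:R)%R] <= (expR (v - y))%:E)%E.
Proof.
move=> Hv; pose q := 1 - F x.
have q01 : 0 <= q <= 1.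
  by rewrite /q; have := df_ge0 F_df F_supp x; have := df_le1 F_df x; lra.
have [fin0 ge0 mgf] := @bernoulli_subpoissonian R.
pose B b := [set z : R | nat_of_bool (x < z) = b].
have mB b : measurable (B b).
  case: b => [|[|b]].
  - rewrite (_ : B 0%N = [set z | z <= x]); first exact: mle.
    by apply/seteqP; split => z; rewrite /B/= leNgt; case: (x < z).
  - rewrite (_ : B 1%N = [set z | x < z]); first exact: mgt.
    by apply/seteqP; split => z; rewrite /B/=; case: (x < z).
  - by rewrite (_ : B b.+2 = set0)//; apply/seteqP; split => z //; rewrite /B/=; case: (x < z).
have PB i b : P (W i @^-1` B b) = bernoulli_prob (Num.min q 1) (nat_of_bool @^-1` [set b]).
  rewrite bernoulli_nat_massE//; case: b => [|[|b]] /=.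
  - rewrite (_ : _ @^-1` _ = W i @^-1` [set y | y <= x]); last first.
      by apply/seteqP; split => w; rewrite /B/= leNgt; case: (x < _).
    by rewrite prob_le_weight mulr0 add0r mulr1 subKr.
  - rewrite (_ : _ @^-1` _ = W i @^-1` [set y | x < y]); last first.
      by apply/seteqP; split => w; rewrite /B/=; case: (x < _).
    by rewrite prob_gt_weight mulr0 addr0 mulr1.
  - rewrite (_ : _ @^-1` _ = set0) ?measure0 ?mulr0 ?addr0//.
    by apply/seteqP; split => w //; rewrite /B/=; case: (x < _).
have := @chernoff _ _ _ P _ (fun i w => nat_of_bool (x < W i w))
  (fun _ _ b => fine (bernoulli_prob (Num.min q 1) (nat_of_bool @^-1` [set b])))
  setT _ _ _ _ _ s y v _.
rewrite setTI => h; apply: le_trans (h _ _ _ _ _ _) _ => {h} //.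
- move=> i; apply: (@measurableT_comp _ _ _ _ _ _ nat_of_bool) => //.
  by apply: measurable_fun_ltr => //; exact: measurable_funPT.
- by move=> _ _ b; apply: fine_ge0; exact: ge0.
- move=> b; rewrite setTI.
  have := W_indep (J := [set: 'I_n]%SET) (B := fun i => B (b i)) (fun i _ => mB (b i)).
  rewrite (_ : \bigcap_(i in _) _ =
    \bigcap_i ((fun w => nat_of_bool (x < W i w)) @^-1` [set b i])); last first.
    by apply/seteqP; split => w h i _; apply: (h i); rewrite /= ?inE.
  move=> ->; rewrite integral_cst//.
  rewrite [X in (_ * X)%E](_ : _ = 1%E) ?mule1 -?prodEFin; last exact: probability_setT.
  apply: eq_big => [i|i _]; first by rewrite inE.
  by rewrite fineK ?PB//; exact: fin0.
- move=> N w _; apply: (@le_trans _ _ (\prod_(i < n) expR (q * (expR s - 1)))).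
    apply: ler_prod => i _; apply/andP; split; last by apply: mgf => /=.
    by apply: sumr_ge0 => b _; rewrite mulr_ge0 ?expR_ge0 ?fine_ge0.
  rewrite -expR_sum ler_expR sumr_const card_ord -mulr_natr; apply: le_trans Hv.
  by rewrite le_eqVlt; apply/orP; left; apply/eqP; rewrite /q; ring.
- by rewrite [X in (_ * X)%E](_ : _ = 1%E) ?mule1//; exact: probability_setT.
Qed.

Lemma measurable_weight_stat j : measurable_fun setT (fun w => weight_stat W w j).
Proof. by apply: measurable_ord_stat. Qed.

Lemma measurable_exceedances x :
  measurable_fun setT (fun w => (exceedances x w)%:R : R).
Proof.
rewrite (_ : (fun w => _) = fun w => \sum_(i < n) (if x < W i w then 1 else 0)).
  apply: measurable_sum => i; apply: measurable_fun_ifT => //.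
  by apply: measurable_fun_ltr => //; exact: measurable_funPT.
by apply/funext => w; rewrite natr_sum; apply: eq_bigr => i _; case: ifP.
Qed.

Let tail_mass t : 1 < t -> n%:R * (1 - F (U t)) = n%:R / t.
Proof. by move=> t1; rewrite F_tail_quantile//; congr (_ * _); lra. Qed.

(** If the expected number of exceedances of U t is at least 3/2 j, fewer than j
    exceedances are exponentially unlikely. The exponent is s = - 1/12, for which
    3/2 (s + 2 s^2) - s = - 1/48. *)
Lemma weight_stat_lower_tail t j : 1 < t -> (0 < j <= n)%N ->
  3 / 2 * j%:R <= n%:R / t ->
  (P [set w | (weight_stat W w j < U t)%R] <= (expR (- (48^-1 * j%:R)))%:E)%E.
Proof.
move=> t1 jn jt.
have es := @expR_le_quadratic R (- 12^-1) ltac:(lra).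
have j0 : 0 <= j%:R :> R by [].
apply: (@le_trans _ _ (P [set w | (- 12^-1 * j%:R <= - 12^-1 * (exceedances (U t) w)%:R)%R])).
  apply: le_measure; rewrite ?inE.
  + exact: (measurable_lt_set (measurable_weight_stat j)).
  + apply: (@measurable_le_set _ _ _ (cst _)) => //; apply: measurable_funM => //.
    exact: measurable_exceedances.
  + move=> w /=; rewrite ltNge /weight_stat le_ord_stat// -ltnNge => h.
    rewrite !mulNr lerN2 ler_pM2l// ler_nat.
    apply: leq_trans (ltnW h); rewrite card_predE /exceedances.
    by apply: leq_sum => i _; case: ltP => // /ltW ->.
apply: le_trans (exceedances_chernoff _
  (v := (- 12^-1 + 2 * 12^-1 ^+ 2) * (3 / 2 * j%:R)) _) _.
- rewrite tail_mass//; apply: (@le_trans _ _ ((- 12^-1 + 2 * 12^-1 ^+ 2) * (n%:R / t))).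
    by apply: ler_wpM2r; [apply: divr_ge0 => //; lra|move: es; rewrite sqrrN; lra].
  by apply: ler_wnM2l => //; lra.
- rewrite lee_fin ler_expR; lra.
Qed.

(** Here the expected number of exceedances is at most 7/8 j, and s = 1/28 gives
    7/8 (s + 2 s^2) - s = - 1/448. *)
Lemma weight_stat_upper_tail t j : 1 < t -> (0 < j <= n)%N ->
  n%:R / t <= 7 / 8 * j%:R ->
  (P [set w | (U t < weight_stat W w j)%R] <= (expR (- (448^-1 * j%:R)))%:E)%E.
Proof.
move=> t1 jn jt.
have es := @expR_le_quadratic R (28^-1) ltac:(by lra).
have j0 : 0 <= j%:R :> R by [].
have es1 : 1 <= expR (28^-1 : R) by rewrite -expR0 ler_expR invr_ge0.
apply: (@le_trans _ _ (P [set w | (28^-1 * j%:R <= 28^-1 * (exceedances (U t) w)%:R)%R])).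
  apply: le_measure; rewrite ?inE.
  + exact: (measurable_lt_set _ (measurable_weight_stat j)).
  + apply: (@measurable_le_set _ _ _ (cst _)) => //; apply: measurable_funM => //.
    exact: measurable_exceedances.
  + move=> w /= Uw; rewrite ler_pM2l// ler_nat.
    have := lexx (weight_stat W w j); rewrite {2}/weight_stat le_ord_stat//.
    move=> /leq_trans; apply; rewrite card_predE /exceedances.
    apply: leq_sum => i _; have [wi|//] := leP (weight_stat W w j) (W i w).
    by rewrite (lt_le_trans Uw wi).
apply: le_trans (exceedances_chernoff _
  (v := (28^-1 + 2 * 28^-1 ^+ 2) * (7 / 8 * j%:R)) _) _.
- have nt0 : 0 <= n%:R / t by apply: divr_ge0 => //; lra.
  by rewrite tail_mass//; apply: ler_pM => //; lra.
- rewrite lee_fin ler_expR; lra.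
Qed.

Lemma prob_ex_weight_le (B : set R) (c : R) : measurable B ->
  (forall i, P (W i @^-1` B) = c%:E) ->
  measurable [set w | exists i, B (W i w)] /\
  (P [set w | exists i, B (W i w)] <= (n%:R * c)%:E)%E.
Proof.
move=> mB PB.
have mWB i : measurable (W i @^-1` B).
  by rewrite -[X in measurable X]setTI; apply: (measurable_funPT (W i)).
have -> : [set w | exists i, B (W i w)] = \big[setU/set0]_i (W i @^-1` B).
  rewrite -bigcup_seq; apply/seteqP; split => [w [i ai]|w [i _ ai]]; last by exists i.
  by exists i => //=; rewrite mem_index_enum.
split; first exact: bigsetU_measurable.
apply: le_trans (measure_bigsetU_le _ _ _ mWB) _.
under eq_bigr do rewrite PB.
by rewrite sumEFin sumr_const card_ord mulr_natl.
Qed.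

Lemma weight_max_tail a : measurable [set w | exists i, a < W i w] /\
  (P [set w | exists i, (a < W i w)%R] <= (n%:R * (1 - F a))%:E)%E.
Proof. exact: (prob_ex_weight_le (mgt a) (fun i => prob_gt_weight i a)). Qed.

Lemma weight_nonpos_null : measurable [set w | exists i, W i w <= 0] /\
  (P [set w | exists i, (W i w <= 0)%R] = 0)%E.
Proof.
have [m0 P0] := prob_ex_weight_le (mle 0) (fun i => prob_le_weight i 0).
split=> //; apply/eqP; rewrite eq_le measure_ge0 andbT; apply: le_trans P0 _.
by rewrite F_supp// mulr0.
Qed.

End counting.

(** * The estimators on one graph *)

Section one_graph.
Context {R : realType} d (T : measurableType d) (P : probability T R) (n : nat).
Variables (F : R -> R) (W : 'I_n -> {RV P >-> R}).
Hypothesis F_df : distribution_function F.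
Hypothesis F_cont : continuous F.
Hypothesis F_supp : forall x : R, x <= 0 -> F x = 0.
Hypothesis W_indep : mutual_independence W.
Hypothesis W_cdf : forall i x, cdf (W i) x = (F x)%:E.
Let U := tail_quantile F.
Variables (law : R -> set nat -> \bar R) (D : set R).
Hypothesis law_ok : subpoissonian_law D law.
Variables (A : 'I_n -> 'I_n -> {RV P >-> nat}).
Hypothesis graphA : ordered_random_graph law W A.
Let Word (i : 'I_n) (w : T) : R := ord_stat (fun j => W j w) i.+1.
Let L w := \sum_(i < n) W i w.
Let G := g_sigma_preimage Word.

Let measureU_le (B C : set T) (b c : R) : measurable B -> measurable C ->
  (P B <= b%:E)%E -> (P C <= c%:E)%E -> (P (B `|` C) <= (b + c)%:E)%E.
Proof.
by move=> mB mC Bb Cc; apply: le_trans (measureU2 _ mB mC) _; rewrite EFinD; exact: leeD.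
Qed.

(** The quantiles are chosen so that U(n / 1.5 k) and U(n / 1.75 k) separate W_(k) from
    W_(2k), and similarly for W_(2k) and W_(4k); both pairs of arguments have ratio
    7/6. *)
Definition weights_typical (k : nat) (w : T) :=
  [/\ U (n%:R / (3 / 2 * k%:R)) <= weight_stat W w k,
      weight_stat W w (2 * k) <= U (n%:R / (7 / 4 * k%:R)),
      U (n%:R / (3 * k%:R)) <= weight_stat W w (2 * k),
      weight_stat W w (4 * k) <= U (n%:R / (7 / 2 * k%:R)) &
      U (n%:R / (6 * k%:R)) <= weight_stat W w (4 * k)].

Lemma weights_typical_whp (k : nat) : (0 < k)%N -> 6 * k%:R < n%:R :> R ->
  exists B, [/\ measurable B, (P B <= (5 * expR (- (448^-1 * k%:R)))%:E)%E &
    forall w, ~ B w -> weights_typical k w].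
Proof.
move=> k0 kn; set e := expR _.
have kR : 0 < k%:R :> R by rewrite ltr0n.
have k4n : (4 * k <= n)%N.
  by apply: ltnW; rewrite -(ltr_nat R) natrM; lra.
pose lo_set j (c : R) := [set w | weight_stat W w (j * k) < U (n%:R / (c * k%:R))].
pose hi_set j (c : R) := [set w | U (n%:R / (c * k%:R)) < weight_stat W w (j * k)].
have lo j (c : R) : (0 < j <= 4)%N -> c = 3 / 2 * j%:R ->
    measurable (lo_set j c) /\ (P (lo_set j c) <= e%:E)%E.
  move=> j14 cE.
  have j1 : 1 <= j%:R :> R by rewrite ler1n; case/andP: j14.
  have j4 : j%:R <= 4 :> R by rewrite ler_nat; case/andP: j14.
  have ck0 : 0 < c * k%:R by nra.
  have nck : n%:R / (n%:R / (c * k%:R)) = c * k%:R.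
    by field; rewrite !gt_eqF//; nra.
  split; first exact: (measurable_lt_set (measurable_weight_stat W (j * k))).
  apply: le_trans (weight_stat_lower_tail F_df F_cont F_supp W_indep W_cdf _ _ _) _.
  - by rewrite ltr_pdivlMr//; nra.
  - by nia.
  - by rewrite nck natrM cE mulrA.
  - by rewrite lee_fin ler_expR natrM; nra.
have hi j (c : R) : (0 < j <= 4)%N -> c = 7 / 8 * j%:R ->
    measurable (hi_set j c) /\ (P (hi_set j c) <= e%:E)%E.
  move=> j14 cE.
  have j1 : 1 <= j%:R :> R by rewrite ler1n; case/andP: j14.
  have j4 : j%:R <= 4 :> R by rewrite ler_nat; case/andP: j14.
  have ck0 : 0 < c * k%:R by nra.
  have nck : n%:R / (n%:R / (c * k%:R)) = c * k%:R.
    by field; rewrite !gt_eqF//; nra.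
  split; first exact: (measurable_lt_set _ (measurable_weight_stat W (j * k))).
  apply: le_trans (weight_stat_upper_tail F_df F_cont F_supp W_indep W_cdf _ _ _) _.
  - by rewrite ltr_pdivlMr//; nra.
  - by nia.
  - by rewrite nck natrM cE mulrA.
  - by rewrite lee_fin ler_expR natrM; nra.
have [m1 p1] := lo 1%N (3 / 2) ltac:(by []) ltac:(lra).
have [m2 p2] := lo 2%N 3 ltac:(by []) ltac:(lra).
have [m4 p4] := lo 4%N 6 ltac:(by []) ltac:(lra).
have [M2 q2] := hi 2%N (7 / 4) ltac:(by []) ltac:(lra).
have [M4 q4] := hi 4%N (7 / 2) ltac:(by []) ltac:(lra).
exists (lo_set 1%N (3 / 2) `|` lo_set 2%N 3 `|` lo_set 4%N 6
  `|` hi_set 2%N (7 / 4) `|` hi_set 4%N (7 / 2)); split.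
- by repeat apply: measurableU => //.
- have -> : 5 * e = e + e + e + e + e by lra.
  have p12 := measureU_le m1 m2 p1 p2; have m12 := measurableU _ _ m1 m2.
  have p123 := measureU_le m12 m4 p12 p4; have m123 := measurableU _ _ m12 m4.
  have p1234 := measureU_le m123 M2 p123 q2.
  exact: measureU_le (measurableU _ _ m123 M2) M4 p1234 q4.
- move=> w /not_orP[/not_orP[/not_orP[/not_orP[h1 h2] h3] h4] h5].
  split; rewrite leNgt; apply/negP; [|exact: h4|exact: h2|exact: h5|exact: h3].
  by rewrite -[X in weight_stat _ _ X]mul1n; exact: h1.
Qed.

Lemma degrees_close_whp (H : set T) (dl m : R) : G H ->
  (forall w i j, H w -> D (Word i w * Word j w / L w)) ->
  (forall w, H w -> L w != 0) -> (forall w i, H w -> 0 <= Word i w) ->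
  0 < dl <= 1 ->
  exists B, [/\ measurable B,
    (P B <= (2 * n%:R * expR (1 - m * dl ^+ 2 / 8))%:E)%E &
    forall w i, H w -> ~ B w ->
      degree A i w <= (1 + dl) * Num.max (Word i w) m /\
      (m <= Word i w -> (1 - dl) * Word i w <= degree A i w)].
Proof.
move=> GH HD HL H0 dl01; set e := expR _.
have mH : measurable H by exact: sigma_weights_measurable GH.
have mW i : measurable_fun setT (Word i) by apply: measurable_ord_stat.
pose hi i := H `&` [set w | (1 + dl) * Num.max (Word i w) m < degree A i w].
pose lo i := H `&` [set w | m <= Word i w /\ degree A i w < (1 - dl) * Word i w].
have mhi i : measurable (hi i).
  apply: measurableI => //; apply: measurable_lt_set; last exact: measurable_degree.
  by apply: measurable_funM => //; apply: measurable_maxr.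
have mlo i : measurable (lo i).
  apply: measurableI => //; apply: measurableI; first exact: measurable_le_set.
  apply: measurable_lt_set; first exact: measurable_degree.
  exact: measurable_funM.
exists (\big[setU/set0]_(i < n) (hi i `|` lo i)); split.
- by apply: bigsetU_measurable => i _; exact: measurableU.
- apply: le_trans (measure_bigsetU_le _ _ _ _) _; first by move=> i; exact: measurableU.
  apply: (@le_trans _ _ (\sum_(i < n) (e + e)%:E)%E).
    apply: lee_sum => i _; apply: measureU_le => //.
      by apply: (degree_upper_tail law_ok graphA) => //; move=> w *; [exact: HD|exact: H0].
    by apply: (degree_lower_tail law_ok graphA) => //; move=> w *; [exact: HD|exact: H0].
  by rewrite sumEFin sumr_const card_ord lee_fin -mulr_natl; nra.
- move=> w i Hw; rewrite -bigcup_seq => Bw; split=> [|mWi]; rewrite leNgt; apply/negP => h;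
    apply: Bw; exists i; rewrite ?/= ?mem_index_enum//; [left|right]; split=> //.
Qed.

(** H collects what is required of the weights for the conditional Chernoff
    bounds to apply, and dl is the relative precision aimed at. *)
Lemma estimators_close_whp (H : set T) (k : nat) (dl c h : R) : G H ->
  (forall w i j, H w -> D (Word i w * Word j w / L w)) ->
  (forall w, H w -> L w != 0) -> (forall w i, H w -> 0 <= Word i w) ->
  (P (~` H) <= h%:E)%E ->
  (1 < k)%N -> 6 * k%:R < n%:R :> R -> 0 < c -> 0 < dl -> (2 + c) / c * dl <= 2^-1 ->
  (forall t, n%:R / (7 / 2 * k%:R) <= t -> (1 + c) * U t <= U (7 / 6 * t)) ->
  exists B, [/\ measurable B,
    (P B <= (h + 5 * expR (- (448^-1 * k%:R)) +
      2 * n%:R * expR (1 - U (n%:R / (6 * k%:R)) * dl ^+ 2 / 8))%:E)%E &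
    forall w, ~ B w ->
      `|hill (degree_stat A w) k - hill (weight_stat W w) k| <= 4 * dl /\
      `|pickands (degree_stat A w) k - pickands (weight_stat W w) k|
        <= (ln 2)^-1 * (4 * ((2 + c) / c * dl))].
Proof.
move=> GH HD HL H0 Hh k1 kn c0 dl0 dl2 gap.
have kR : 1 < k%:R :> R by rewrite ltr1n.
have k0 : (0 < k)%N by apply: ltnW.
have k4n : (4 * k <= n)%N by apply: ltnW; rewrite -(ltr_nat R) natrM; lra.
have mH : measurable H by exact: sigma_weights_measurable GH.
have c2 : 1 <= (2 + c) / c by rewrite ler_pdivlMr//; lra.
have dl12 : dl <= 2^-1 by nra.
set m := U (n%:R / (6 * k%:R)).
have m0 : 0 < m.
  by apply: (tail_quantile_gt0 F_df F_cont F_supp); rewrite ltr_pdivlMr; lra.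
have [B1 [mB1 PB1 typ]] := weights_typical_whp k0 kn.
have dlP : 0 < dl <= 1 by lra.
have dl01 : 0 <= dl <= 1 by lra.
have k4 : (0 < 4 * k <= n)%N by rewrite muln_gt0 k0.
have i1 i : (0 < i <= k)%N -> (0 < i <= 4 * k)%N.
  by move=> /andP[-> ik]; apply: leq_trans ik _; exact: leq_pmull.
have nR : 0 < n%:R :> R by lra.
have k72 : 0 < 7 / 2 * k%:R :> R by lra.
have k74 : 0 < 7 / 4 * k%:R :> R by lra.
have kk : 7 / 4 * k%:R <= 7 / 2 * k%:R :> R by lra.
have c1 : 0 <= 1 + c by lra.
have t1E : n%:R / (3 / 2 * k%:R) = 7 / 6 * (n%:R / (7 / 4 * k%:R)) :> R.
  by field; rewrite gt_eqF//; lra.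
have t2E : n%:R / (3 * k%:R) = 7 / 6 * (n%:R / (7 / 2 * k%:R)) :> R.
  by field; rewrite gt_eqF//; lra.
have gap1 : (1 + c) * U (n%:R / (7 / 4 * k%:R)) <= U (n%:R / (3 / 2 * k%:R)).
  rewrite t1E; apply: gap; apply: ler_wpM2l; first exact: ltW.
  by rewrite lef_pV2.
have gap2 : (1 + c) * U (n%:R / (7 / 2 * k%:R)) <= U (n%:R / (3 * k%:R)).
  by rewrite t2E; exact: gap.
clear kn kR gap.
have [B2 [mB2 PB2 cl]] := degrees_close_whp m GH HD HL H0 dlP.
exists (~` H `|` B1 `|` B2); split.
- by apply: measurableU => //; apply: measurableU => //; exact: measurableC.
- apply: measureU_le => //; first by apply: measurableU => //; exact: measurableC.
  by apply: measureU_le => //; exact: measurableC.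
move=> w /not_orP[/not_orP[/contrapT Hw nB1] nB2].
have [w1 w2u w2 w4u w4] := typ w nB1.
have sandwich i : (0 < i <= 4 * k)%N ->
    0 < weight_stat W w i /\
    `|degree_stat A w i - weight_stat W w i| <= dl * weight_stat W w i.
  move=> i04; have := @ord_stat_sandwich R n (fun j => W j w) (fun j => degree A j w) dl m
    (4 * k) dl01 k4 w4 (fun j => (cl w j Hw nB2).1)
    (fun j => (cl w j Hw nB2).2) i i04.
  rewrite -/(weight_stat W w i) -/(degree_stat A w i) => /andP[lo hi]; split.
    apply: lt_le_trans m0 (le_trans w4 _); apply: ord_stat_homo.
      by case/andP: i04 => _ ->; case/andP: k4.
    by case/andP: k4.
  rewrite ler_norml lerBrDr lerBlDr; apply/andP.
  split; [apply: le_trans lo|apply: le_trans hi _].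
    by rewrite mulrBl mul1r addrC.
  by rewrite mulrDl mul1r addrC.
split.
  by apply: hill_close => // i ik; apply: sandwich; exact: i1.
apply: pickands_close => //; first exact: ltW.
  by apply: le_trans w1; apply: le_trans gap1; apply: ler_wpM2l.
by apply: le_trans w2; apply: le_trans gap2; apply: ler_wpM2l.
Qed.

End one_graph.

(** * Convergence in probability *)

(** On each half line the inverse is a composition of [ln] and [expR]. *)
Lemma measurable_fun_inv {R : realType} d (T : measurableType d) (f : T -> R) :
  measurable_fun setT f -> measurable_fun setT (fun w => (f w)^-1).
Proof.
move=> mf.
rewrite (_ : (fun w => _) = fun w => if 0 < f w then expR (- ln (f w))
  else if f w < 0 then - expR (- ln (- f w)) else 0).
  apply: measurable_fun_ifT; first exact: measurable_fun_ltr.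
    by apply: measurableT_comp => //; apply: measurable_funN; exact: measurableT_comp.
  apply: measurable_fun_ifT => //; first exact: measurable_fun_ltr.
  apply: measurable_funN; apply: measurableT_comp => //; apply: measurable_funN.
  by apply: measurableT_comp => //; exact: measurable_funN.
apply/funext => w; case: ltgtP => [f0|f0|<-]; last by rewrite invr0.
  by rewrite expRN lnK ?posrE.
by rewrite expRN lnK ?posrE ?oppr_gt0// invrN opprK.
Qed.

Lemma measurable_hill {R : realType} d (T : measurableType d) (x : nat -> T -> R) k :
  (forall i, measurable_fun setT (x i)) -> measurable_fun setT (fun w => hill (x ^~ w) k).
Proof.
move=> mx; apply: measurable_funM => //; apply: measurable_sum => i.
apply: measurableT_comp => //; apply: measurable_funM => //; exact: measurable_fun_inv.
Qed.

Lemma measurable_pickands {R : realType} d (T : measurableType d) (x : nat -> T -> R) k :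
  (forall i, measurable_fun setT (x i)) -> measurable_fun setT (fun w => pickands (x ^~ w) k).
Proof.
move=> mx; apply: measurable_funM => //; apply: measurableT_comp => //.
apply: measurable_funM; first exact: measurable_funB.
by apply: measurable_fun_inv; exact: measurable_funB.
Qed.

Section convergence.
Context {R : realType} (d : nat -> measure_display) (T : forall n, measurableType (d n))
  (P : forall n, probability (T n) R).

(** Exceptional sets that depend on the precision eps are enough. Measurability
    of X n is what allows the probability of a deviation to be compared with
    that of the exceptional set. *)
Lemma cvg_in_probability_of_bound (X : forall n, T n -> R) :
  (forall n, measurable_fun setT (X n)) ->
  (forall eps, 0 < eps -> exists2 b : nat -> R, b n @[n --> \oo] --> (0 : R) &
    \forall n \near \oo, exists B : set (T n),
      [/\ measurable B, (P n B <= (b n)%:E)%E & forall w, ~ B w -> `|X n w| <= eps]) ->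
  cvg_in_probability P X 0.
Proof.
move=> mX bnd eps eps0; have [b b0 nb] := bnd eps eps0.
have b0' : (b n)%:E @[n --> \oo] --> (0 : \bar R).
  by apply: cvg_EFin => //; exact: nearW.
apply: (squeeze_cvge _ (cvg_cst _) b0'); near=> n.
rewrite measure_ge0 /=.
have [B [mB PB XB]] : exists B : set (T n),
      [/\ measurable B, (P n B <= (b n)%:E)%E & forall w, ~ B w -> `|X n w| <= eps].
  by near: n.
apply: le_trans PB; apply: le_measure; rewrite ?inE//.
  apply: (measurable_lt_set (f := cst eps)) => //.
  by apply: measurableT_comp => //; exact: measurable_funB.
by move=> w /=; rewrite subr0 => Xw; apply: contrapT => /XB; rewrite leNgt Xw.
Unshelve. all: by end_near. Qed.

Lemma expRN_cvg0 (c : R) (k : nat -> nat) : 0 < c -> k n @[n --> \oo] --> \oo ->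
  expR (- (c * (k n)%:R)) @[n --> \oo] --> (0 : R).
Proof.
move=> c0 kc; apply/cvgr0Pnorm_lt => eps eps0; near=> n.
have kn : (c * eps)^-1 <= (k n)%:R by near: n; exact: (kc _ (nbhs_infty_ger _)).
rewrite ger0_norm ?expR_ge0// expRN.
have ck : eps^-1 <= c * (k n)%:R.
  by move: kn; rewrite invfM -ler_pdivrMl ?invr_gt0// invrK.
rewrite -[eps]invrK ltf_pV2 ?posrE ?expR_gt0 ?invr_gt0//.
by apply: lt_le_trans (expR_ge1Dx _); lra.
Unshelve. all: by end_near. Qed.

Variables (alpha : R) (F : R -> R) (k : nat -> nat).
Variables (W : forall n, 'I_n -> {RV (P n) >-> R})
  (A : forall n, 'I_n -> 'I_n -> {RV (P n) >-> nat}).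
Arguments W : clear implicits.
Arguments A : clear implicits.
Hypothesis alpha_gt0 : 0 < alpha.
Hypothesis F_df : distribution_function F.
Hypothesis F_cont : continuous F.
Hypothesis F_supp : forall x : R, x <= 0 -> F x = 0.
Hypothesis W_indep : forall n, mutual_independence (W n).
Hypothesis W_cdf : forall n (i : 'I_n) (x : R), cdf (W n i) x = (F x)%:E.
Let U := tail_quantile F.
Hypothesis U_lower : exists t0 eta : R, [/\ 0 < t0, 0 <= eta < 1 &
     forall t x : R, t0 <= t -> 1 <= x ->
       (1 - eta) * x `^ (1 / alpha) + eta <= U (t * x) / U t].
Hypothesis k_gt0 : forall n, (0 < k n)%N.
Hypothesis k_cvg : k n @[n --> \oo] --> \oo.
Hypothesis k_rate : (k n)%:R * ln (n%:R : R) `^ alpha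
              / n%:R `^ (1 / (4 * alpha + 1)) @[n --> \oo] --> (0 : R).

Let gamma_gt0 : 0 < 1 / alpha. Proof. by rewrite divr_gt0. Qed.

(** With m = U(n / 6k) of order at least (n / k)^(1 / alpha), the exponent
    m e^2 / 8k exceeds 2 ln n eventually, so that the union bound over n nodes is
    O(1 / n). *)
Lemma degree_deviation_cvg0 (e : R) : 0 < e ->
  2 * n%:R * expR (1 - U (n%:R / (6 * (k n)%:R)) *
    (e / Num.sqrt (k n)%:R) ^+ 2 / 8) @[n --> \oo] --> (0 : R).
Proof.
move=> e0; have [c [t1 [c0 t11 grow]]] :=
  tail_quantile_growth F_df F_cont F_supp U_lower.
have [s6 [s60 s6E]] : exists s, 0 < s /\ s = 6 `^ (1 / alpha) :> R.
  by exists (6 `^ (1 / alpha)); rewrite powR_gt0.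
apply/cvgr0Pnorm_lt => eps eps0; near=> n.
have n0 : 0 < n%:R :> R by rewrite ltr0n; near: n; exact: nbhs_infty_gt.
have kR : 0 < (k n)%:R :> R by rewrite ltr0n.
have kt : 6 * t1 * (k n)%:R <= n%:R.
  by near: n; apply: filterS (rank_rate_growth alpha_gt0 k_gt0 k_rate (6 * t1)) => ? [].
have kl : 16 / e ^+ 2 * s6 / c * ((k n)%:R * ln (n%:R : R)) <=
    (n%:R / (k n)%:R) `^ (1 / alpha).
  near: n.
  by apply: filterS (rank_rate_growth alpha_gt0 k_gt0 k_rate (16 / e ^+ 2 * s6 / c)) => ? [].
have nlarge : 2 * expR 1 / eps + 1 <= n%:R by near: n; exact: nbhs_infty_ger.
have k6 : 0 < 6 * (k n)%:R :> R by rewrite mulr_gt0.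
have nk : t1 <= n%:R / (6 * (k n)%:R) by rewrite ler_pdivlMr//; lra.
have Un := grow _ nk.
have e2 : 0 < e ^+ 2 by rewrite exprn_gt0.
have nkE : (n%:R / (6 * (k n)%:R)) `^ (1 / alpha) = (n%:R / (k n)%:R) `^ (1 / alpha) / s6.
  rewrite (_ : n%:R / (k n)%:R = n%:R / (6 * (k n)%:R) * 6); last by field; rewrite gt_eqF.
  by rewrite [in RHS]powRM ?divr_ge0 ?(ltW n0) ?(ltW k6)// s6E mulfK// gt_eqF// powR_gt0.
rewrite nkE in Un.
have key : 2 * ln (n%:R : R) <= U (n%:R / (6 * (k n)%:R)) * (e / Num.sqrt (k n)%:R) ^+ 2 / 8.
  rewrite expr_div_n sqr_sqrtr ?(ltW kR)//.
  apply: (@le_trans _ _ (c * ((n%:R / (k n)%:R) `^ (1 / alpha) / s6)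
      * (e ^+ 2 / (k n)%:R) / 8)).
    apply: (@le_trans _ _ (c * ((16 / e ^+ 2 * s6 / c * ((k n)%:R * ln (n%:R : R))) / s6)
        * (e ^+ 2 / (k n)%:R) / 8)).
      rewrite le_eqVlt; apply/orP; left; apply/eqP; field.
      by rewrite !gt_eqF.
    do 2 (apply: ler_wpM2r; first by rewrite ?divr_ge0 ?invr_ge0 ?(ltW kR) ?(ltW e2)).
    apply: ler_wpM2l; first exact: ltW.
    by apply: ler_wpM2r; first by rewrite invr_ge0 ltW.
  do 2 (apply: ler_wpM2r; first by rewrite ?divr_ge0 ?invr_ge0 ?(ltW kR) ?(ltW e2)).
  exact: Un.
rewrite ger0_norm; last by rewrite mulr_ge0 ?expR_ge0// mulr_ge0// ltW.
set Y := U _ * _ / 8 in key *.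
apply: (@le_lt_trans _ _ (2 * n%:R * expR (1 - 2 * ln (n%:R : R)))).
  apply: ler_wpM2l; first by rewrite mulr_ge0// ltW.
  by rewrite ler_expR; lra.
have -> : 1 - 2 * ln (n%:R : R) = 1 + (- ln (n%:R : R) + - ln (n%:R : R)) by lra.
rewrite !expRD expRN lnK ?posrE//.
have -> : 2 * n%:R * (expR 1 * (n%:R^-1 * n%:R^-1)) = 2 * expR 1 / n%:R :> R.
  by field; rewrite gt_eqF.
rewrite ltr_pdivrMr// [eps * _]mulrC -ltr_pdivrMr//; lra.
Unshelve. all: by end_near. Qed.

Section subpoissonian_graphs.
Variables (law : R -> set nat -> \bar R) (D : set R).
Hypothesis law_ok : subpoissonian_law D law.
Hypothesis graphA : forall n, ordered_random_graph law (W n) (A n).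
Let Word n (i : 'I_n) w : R := ord_stat (fun j => W n j w) i.+1.
Arguments Word : clear implicits.
Let L n w := \sum_(i < n) W n i w.
Arguments L : clear implicits.
(** [H n] is an event on which the weights behave, of probability tending to 1.
    Apart from [law] and [D], it is what the two models do not share. *)
Variables (H : forall n, set (T n)) (h : nat -> R).
Arguments H : clear implicits.
Hypothesis h0 : h n @[n --> \oo] --> (0 : R).
Hypothesis HP : \forall n \near \oo,
  [/\ g_sigma_preimage (Word n) (H n),
      forall w i j, H n w -> D (Word n i w * Word n j w / L n w),
      forall w, H n w -> L n w != 0,
      forall w (i : 'I_n), H n w -> 0 <= Word n i w &
      (P n (~` H n) <= (h n)%:E)%E].

Lemma estimators_bound (eps : R) : 0 < eps ->
  exists2 b : nat -> R, b n @[n --> \oo] --> (0 : R) &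
    \forall n \near \oo, exists B : set (T n),
      [/\ measurable B, (P n B <= (b n)%:E)%E & forall w, ~ B w ->
       Num.sqrt (k n)%:R * `|hill (degree_stat (A n) w) (k n)
                            - hill (weight_stat (W n) w) (k n)| <= eps /\
       Num.sqrt (k n)%:R * `|pickands (degree_stat (A n) w) (k n)
                            - pickands (weight_stat (W n) w) (k n)| <= eps].
Proof.
move=> eps0.
have [c [t1 [c0 t11 gap]]] := tail_quantile_gap F_df F_cont F_supp gamma_gt0 U_lower
  (x := 7 / 6) ltac:(lra).
have ln2 : 0 < ln 2 :> R by rewrite ln_gt0// ltr1n.
pose K := (2 + c) / c.
have K1 : 1 <= K by rewrite /K ler_pdivlMr//; lra.
pose C := 4 + (ln 2)^-1 * (4 * K).
have iln2 : 0 < (ln 2)^-1 :> R by rewrite invr_gt0.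
have CK : 0 <= (ln 2)^-1 * (4 * K) by rewrite mulr_ge0//; lra.
have C0 : 0 < C by rewrite /C; lra.
(* With dl = e / sqrt k, the errors 4 dl and 4 K dl / ln 2, multiplied by sqrt k,
   are at most C e. *)
pose e := eps / C; have e0 : 0 < e by rewrite divr_gt0.
exists (fun n => h n + 5 * expR (- (448^-1 * (k n)%:R)) + 2 * n%:R *
   expR (1 - U (n%:R / (6 * (k n)%:R)) * (e / Num.sqrt (k n)%:R) ^+ 2 / 8)).
  rewrite -[0 in X in _ --> X](addr0 0); apply: cvgD; last exact: degree_deviation_cvg0.
  rewrite -[0 in X in _ --> X](addr0 0); apply: cvgD => //.
  rewrite -[0 in X in _ --> X](mulr0 5); apply: cvgM; first exact: cvg_cst.
  by apply: expRN_cvg0.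
near=> n.
have [GH HD HL HW PH] : [/\ g_sigma_preimage (Word n) (H n),
      forall w i j, H n w -> D (Word n i w * Word n j w / L n w),
      forall w, H n w -> L n w != 0,
      forall w (i : 'I_n), H n w -> 0 <= Word n i w &
      (P n (~` H n) <= (h n)%:E)%E] by near: n; exact: HP.
have k1 : (1 < k n)%N by near: n; exact: (k_cvg (nbhs_infty_gt 1)).
have kR : 0 < (k n)%:R :> R by rewrite ltr0n.
have sk : 0 < Num.sqrt (k n)%:R :> R by rewrite sqrtr_gt0.
have kt : (7 * t1 + 7) * (k n)%:R <= n%:R.
  by near: n; apply: filterS (rank_rate_growth alpha_gt0 k_gt0 k_rate (7 * t1 + 7)) => ? [].
set dl := e / Num.sqrt (k n)%:R.
have dl0 : 0 < dl by rewrite divr_gt0.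
have kbig : (2 * K * e) ^+ 2 <= (k n)%:R by near: n; exact: (k_cvg (nbhs_infty_ger _)).
have Ke : 0 <= 2 * K * e by apply: mulr_ge0; [lra|exact: ltW].
have skbig : 2 * K * e <= Num.sqrt (k n)%:R.
  by rewrite -[leLHS](ger0_norm Ke) -sqrtr_sqr ler_sqrt// ltW.
have Kdl : K * dl <= 2^-1.
  by rewrite /dl mulrA ler_pdivrMr//; lra.
have k6 : 6 * (k n)%:R < n%:R :> R.
  by apply: lt_le_trans kt; rewrite ltr_pM2r//; lra.
have k72 : t1 <= n%:R / (7 / 2 * (k n)%:R).
  rewrite ler_pdivlMr; last by rewrite mulr_gt0//; lra.
  by apply: le_trans kt; rewrite mulrA ler_pM2r//; lra.
have [B [mB PB HB]] := estimators_close_whp F_df F_cont F_supp (@W_indep n) (@W_cdf n)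
  law_ok (@graphA n) GH HD HL HW PH k1 k6 c0 dl0 Kdl
  (fun t tt => gap t (le_trans k72 tt)).
exists B; split=> // w /HB[hill_le pick_le].
have skdl : Num.sqrt (k n)%:R * dl = e by rewrite /dl mulrC divfK ?gt_eqF.
have CE : C * e = eps by rewrite /e mulrC divfK ?gt_eqF.
split.
  apply: le_trans (ler_wpM2l (ltW sk) hill_le) _.
  by rewrite mulrCA skdl -CE; apply: ler_wpM2r; [exact: ltW|rewrite /C; lra].
apply: le_trans (ler_wpM2l (ltW sk) pick_le) _.
have -> : Num.sqrt (k n)%:R * ((ln 2)^-1 * (4 * ((2 + c) / c * dl))) =
  (ln 2)^-1 * (4 * K) * (Num.sqrt (k n)%:R * dl) by rewrite /K; ring.
by rewrite skdl -CE; apply: ler_wpM2r; [exact: ltW|rewrite /C; lra].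
Unshelve. all: by end_near. Qed.

Lemma estimators_cvg :
  cvg_in_probability P (fun n w => Num.sqrt (k n)%:R *
      `|hill (degree_stat (A n) w) (k n) - hill (weight_stat (W n) w) (k n)|) 0
  /\
  cvg_in_probability P (fun n w => Num.sqrt (k n)%:R *
      `|pickands (degree_stat (A n) w) (k n)
        - pickands (weight_stat (W n) w) (k n)|) 0.
Proof.
have mW n i : measurable_fun setT (fun w => weight_stat (W n) w i).
  exact: measurable_weight_stat.
have mD n i : measurable_fun setT (fun w => degree_stat (A n) w i).
  by apply: measurable_ord_stat => j; exact: measurable_degree.
split; apply: cvg_in_probability_of_bound => [n|eps eps0].
- apply: measurable_funM => //; apply: measurableT_comp => //.
  by apply: measurable_funB;
    [exact: (measurable_hill _ (mD n))|exact: (measurable_hill _ (mW n))].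
- have [b b0 nb] := estimators_bound eps0; exists b => //.
  apply: filterS nb => n [B [mB PB HB]]; exists B; split=> // w /HB[+ _].
  by rewrite normrM normr_id (ger0_norm (sqrtr_ge0 _)).
- apply: measurable_funM => //; apply: measurableT_comp => //.
  by apply: measurable_funB;
    [exact: (measurable_pickands _ (mD n))|exact: (measurable_pickands _ (mW n))].
- have [b b0 nb] := estimators_bound eps0; exists b => //.
  apply: filterS nb => n [B [mB PB HB]]; exists B; split=> // w /HB[_].
  by rewrite normrM normr_id (ger0_norm (sqrtr_ge0 _)).
Qed.

End subpoissonian_graphs.
End convergence.

(** * The two models *)

Section models.
Context {R : realType} d (T : measurableType d) (P : probability T R) (n : nat).
Variables (F : R -> R) (W : 'I_n -> {RV P >-> R}).
Hypothesis F_df : distribution_function F.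
Hypothesis F_cont : continuous F.
Hypothesis F_supp : forall x : R, x <= 0 -> F x = 0.
Hypothesis W_indep : mutual_independence W.
Hypothesis W_cdf : forall i x, cdf (W i) x = (F x)%:E.
Let U := tail_quantile F.
Let Word (i : 'I_n) (w : T) : R := ord_stat (fun j => W j w) i.+1.
Let L w := \sum_(i < n) W i w.
Let G := g_sigma_preimage Word.

Definition weights_pos : set T := \bigcap_i (Word i @^-1` [set x | 0 < x]).

(** The weights are at most a and a quarter of them are at least the median. For
    n >= 4 and a^2 = U(2) n / 8 this forces W_(i) W_(j) <= L for all i and j. *)
Definition weights_truncated (a : R) : set T :=
  \bigcap_i (Word i @^-1` [set x | 0 < x /\ x <= a /\ ((i < n %/ 4)%N -> U 2 <= x)]).

Lemma sigma_weights_bigcap (B : 'I_n -> set R) : (forall i, measurable (B i)) ->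
  G (\bigcap_i (Word i @^-1` B i)).
Proof.
move=> mB; have := @fin_bigcap_measurable _ (g_sigma_algebraType
  (\big[setU/set0]_(i < n) preimage_set_system setT (Word i) measurable)) _ [set: 'I_n]
  (fun i => Word i @^-1` B i).
by apply => // i _; exact: preimage_sigma_weights.
Qed.

Let mgt x : measurable [set y : R | x < y].
Proof. exact: (measurable_lt_set (f := cst x) (g := id)). Qed.

Let mle x : measurable [set y : R | y <= x].
Proof. exact: (measurable_le_set (f := id) (g := cst x)). Qed.

Lemma weights_pos_sigma : G weights_pos.
Proof. by apply: sigma_weights_bigcap => i; exact: mgt. Qed.

Lemma weights_truncated_sigma a : G (weights_truncated a).
Proof.
have mb (b : bool) : measurable [set x | b -> U 2 <= x].
  case: b; last by rewrite (_ : [set x | _] = setT)//; apply/seteqP; split.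
  rewrite (_ : [set x | _] = [set x | U 2 <= x]).
    exact: (measurable_le_set (f := cst (U 2)) (g := id)).
  by apply/seteqP; split=> x /=; [apply|].
apply: sigma_weights_bigcap => i; apply: measurableI; first exact: mgt.
by apply: measurableI; [exact: mle | exact: mb].
Qed.

Let L_Word w : L w = \sum_i Word i w.
Proof. by rewrite /L /Word sum_ord_stat. Qed.

Lemma weights_pos_total w : (0 < n)%N -> weights_pos w -> 0 < L w.
Proof.
move=> n0 Hw; rewrite L_Word (bigD1 (Ordinal n0))//=.
by rewrite ltr_wpDr ?sumr_ge0// => [i _|]; [exact/ltW/(Hw i)|exact: (Hw (Ordinal n0))].
Qed.

Lemma weights_posC_null : P (~` weights_pos) = 0%E.
Proof.
have [mN PN] := weight_nonpos_null F_supp W_cdf.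
apply/eqP; rewrite eq_le measure_ge0 andbT -PN; apply: le_measure; rewrite ?inE.
- by apply: measurableC; exact: sigma_weights_measurable weights_pos_sigma.
- exact: mN.
- move=> w Hw /=; apply: contrapT => nex; apply: Hw => i _ /=.
  have [j Wij] := ord_stat_attained (fun j => W j w) i; rewrite /Word Wij.
  by rewrite ltNge; apply/negP => Wj; apply: nex; exists j.
Qed.

Lemma weights_truncated_pos a w : weights_truncated a w -> weights_pos w.
Proof. by move=> Hw i _; have [] := Hw i Logic.I. Qed.

Lemma weights_truncated_rate a w i j : (4 <= n)%N -> a ^+ 2 <= U 2 / 8 * n%:R ->
  weights_truncated a w -> 0 <= Word i w * Word j w / L w <= 1.
Proof.
move=> n4 an Hw.
have n0 : (0 < n)%N by apply: leq_trans n4.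
have L0 := weights_pos_total n0 (weights_truncated_pos Hw).
have [i0 [ia _]] := Hw i Logic.I; have [j0 [ja _]] := Hw j Logic.I.
have U2 : 0 < U 2 by apply: (tail_quantile_gt0 F_df F_cont F_supp); rewrite ltr1n.
apply/andP; split; first by rewrite divr_ge0 ?mulr_ge0// ltW.
rewrite ler_pdivrMr// mul1r; apply: (@le_trans _ _ (a ^+ 2)).
  by rewrite expr2; apply: ler_pM => //; exact: ltW.
apply: le_trans an _; apply: (@le_trans _ _ (U 2 * (n %/ 4)%:R)).
  rewrite -mulrA; apply: ler_wpM2l; first exact: ltW.
  by rewrite ler_pdivrMl// -natrM ler_nat; lia.
rewrite L_Word (bigID (fun i : 'I_n => (i < n %/ 4)%N)) /=.
rewrite -[leLHS]addr0; apply: lerD; last first.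
  by apply: sumr_ge0 => l _; have [/ltW] := Hw l Logic.I.
apply: (@le_trans _ _ (\sum_(l < n | (l < n %/ 4)%N) U 2)).
  rewrite -(big_ord_widen _ (fun=> U 2)) ?leq_div// sumr_const card_ord.
  by rewrite mulr_natr.
by apply: ler_sum => l l4; have [_ [_]] := Hw l Logic.I; apply.
Qed.

Lemma weights_truncatedC_le a : (4 <= n)%N ->
  (P (~` weights_truncated a) <=
   (n%:R * (1 - F a) + expR (- (48^-1 * (n %/ 4)%:R)))%:E)%E.
Proof.
move=> n4; set m := (n %/ 4)%N.
have mpos : measurable weights_pos by exact: sigma_weights_measurable weights_pos_sigma.
have [mB PB] := weight_max_tail W_cdf a.
have mS : measurable [set w | weight_stat W w m < U 2].
  exact: (measurable_lt_set (measurable_weight_stat W m)).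
apply: (@le_trans _ _ (P (~` weights_pos `|` [set w | exists i, a < W i w] `|`
   [set w | weight_stat W w m < U 2]))).
  apply: le_measure; rewrite ?inE.
  - apply: measurableC; exact: sigma_weights_measurable (weights_truncated_sigma a).
  - by apply: measurableU => //; apply: measurableU => //; exact: measurableC.
  - move=> w Hw; apply: contrapT => /not_orP[/not_orP[/contrapT pos na] nS].
    apply: Hw => i _; split; [exact: pos|split].
      have [j Wij] := ord_stat_attained (fun j => W j w) i; rewrite /Word Wij.
      by rewrite leNgt; apply/negP => aj; apply: na; exists j.
    move=> im; apply: (@le_trans _ _ (weight_stat W w m)).
      by rewrite leNgt; apply/negP.
    by apply: ord_stat_homo; rewrite /m; lia.
apply: le_trans (measureU2 _ _ _) _ => //.
  by apply: measurableU => //; exact: measurableC.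
rewrite EFinD; apply: leeD.
  apply: le_trans (measureU2 _ _ _) _ => //; first exact: measurableC.
  rewrite -[leRHS]add0e; apply: leeD; last exact: PB.
  by rewrite le_eqVlt; apply/orP; left; apply/eqP; exact: weights_posC_null.
apply: (weight_stat_lower_tail F_df F_cont F_supp W_indep W_cdf).
- by rewrite ltr1n.
- by rewrite /m; lia.
- have : 4 * m%:R <= n%:R :> R by rewrite -natrM ler_nat /m; lia.
  by have : 0 <= m%:R :> R by []; lra.
Qed.

End models.

Theorem lemma13 (R : realType) (alpha gamma : R) (F : R -> R)
  (d : nat -> measure_display) (T : forall n, measurableType (d n))
  (P : forall n, probability (T n) R)
  (W : forall n, 'I_n -> {RV (P n) >-> R})
  (A : forall n, 'I_n -> 'I_n -> {RV (P n) >-> nat})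
  (k : nat -> nat)
  (alpha_gt0 : 0 < alpha) (gammaE : gamma = 1 / alpha)
  (F_df : distribution_function F) (F_continuous : continuous F)
  (F_support : forall x : R, x <= 0 -> F x = 0)
  (W_indep : forall n, mutual_independence (W n))
  (W_cdf : forall n (i : 'I_n) (x : R), cdf (W n i) x = (F x)%:E)
  (U_regvar : forall x : R, 0 < x ->
     tail_quantile F (t * x) / tail_quantile F t @[t --> +oo] --> x `^ gamma)
  (U_lower : exists t0 eta : R, [/\ 0 < t0, 0 <= eta < 1 &
     forall t x : R, t0 <= t -> 1 <= x ->
       (1 - eta) * x `^ gamma + eta <=
         tail_quantile F (t * x) / tail_quantile F t])
  (model : (forall n, ordered_norros_reittu (W n) (A n)) \/
           2 < alpha /\ (forall n, ordered_chung_lu (W n) (A n)))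
  (k_gt0 : forall n, (0 < k n)%N)
  (k_cvg : k n @[n --> \oo] --> \oo)
  (k_rate : (k n)%:R * ln (n%:R : R) `^ alpha
              / n%:R `^ (1 / (4 * alpha + 1)) @[n --> \oo] --> (0 : R)) :
  cvg_in_probability P (fun n w =>
    Num.sqrt (k n)%:R *
      `|hill (degree_stat (A n) w) (k n) - hill (weight_stat (W n) w) (k n)|) 0
  /\
  cvg_in_probability P (fun n w =>
    Num.sqrt (k n)%:R *
      `|pickands (degree_stat (A n) w) (k n)
        - pickands (weight_stat (W n) w) (k n)|) 0.
Proof.
have gamma_gt0 : 0 < 1 / alpha by rewrite divr_gt0.
rewrite gammaE in U_regvar U_lower.
have near4 : \forall n \near \oo, (4 <= n)%N by exact: nbhs_infty_ge.
case: model => [nr|[alpha2 cl]].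
  apply: (estimators_cvg alpha_gt0 F_df F_continuous F_support W_indep W_cdf U_lower
    k_gt0 k_cvg k_rate (@poisson_subpoissonian R) nr
    (H := fun n => weights_pos (W n)) (h := fun=> 0)); first exact: cvg_cst.
  apply: filterS near4 => n n4; have n0 : (0 < n)%N by apply: leq_trans n4.
  split.
  - exact: weights_pos_sigma.
  - move=> w i j Hw; apply: divr_gt0; last exact: weights_pos_total.
    by apply: mulr_gt0; [exact: (Hw i)|exact: (Hw j)].
  - by move=> w Hw; rewrite gt_eqF//; exact: weights_pos_total.
  - by move=> w i Hw; apply: ltW; exact: (Hw i).
  - rewrite le_eqVlt; apply/orP; left; apply/eqP.
    exact: (weights_posC_null F_support (W_cdf n)).
(* Any exponent strictly between gamma and 1/2. *)
pose g := (1 / alpha + 2^-1) / 2.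
have gamma2 : 1 / alpha < 2^-1 by rewrite div1r ltf_pV2 ?posrE.
have [gg g2] : 1 / alpha < g /\ g < 2^-1 by rewrite /g; split; lra.
have U2 : 0 < tail_quantile F 2.
  by apply: (tail_quantile_gt0 F_df F_continuous F_support); rewrite ltr1n.
pose a n : R := Num.sqrt (tail_quantile F 2 / 8 * n%:R).
have dbl := tail_quantile_doubling F_df F_continuous F_support gg (U_regvar 2 ltac:(by [])).
apply: (estimators_cvg alpha_gt0 F_df F_continuous F_support W_indep W_cdf U_lower
  k_gt0 k_cvg k_rate (@bernoulli_subpoissonian R) cl
  (H := fun n => weights_truncated F (W n) (a n))
  (h := fun n => n%:R * (1 - F (a n)) + expR (- (48^-1 * (n %/ 4)%:R)))).
  rewrite -[0 in X in _ --> X](addr0 0); apply: cvgD.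
    apply: (df_tail_vanish F_df F_continuous F_support _ g2 _ dbl).
      exact: lt_trans gg.
    by rewrite divr_gt0.
  apply: expRN_cvg0; last exact: cvg_divnr.
  by rewrite invr_gt0.
apply: filterS near4 => n n4; have n0 : (0 < n)%N by apply: leq_trans n4.
have an : a n ^+ 2 <= tail_quantile F 2 / 8 * n%:R.
  by rewrite /a sqr_sqrtr// mulr_ge0// ltW// divr_gt0.
split.
- exact: weights_truncated_sigma.
- by move=> w i j Hw; exact: (weights_truncated_rate F_df F_continuous F_support _ _ n4 an Hw).
- move=> w Hw; rewrite gt_eqF//; apply: (weights_pos_total n0).
  exact: weights_truncated_pos Hw.
- by move=> w i Hw; have [/ltW] := Hw i Logic.I.
- exact: (weights_truncatedC_le F_df F_continuous F_support (W_indep n) (W_cdf n)).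
Qed.
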